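(* Let $N\ge1$, $t_0>0$, and let $G\in\mathbb{R}^{N\times N}$ be normal ($GG^\top=G^\top G$) with eigenvalues $\lambda_1,\dots,\lambda_N\in\mathbb{C}$. Suppose $\Re(\lambda_i)>0$ for all $i$, and suppose at least one eigenvalue has the form $\lambda_j=a+ib$ with $a,b\in\mathbb{R}$, $b\ne0$. Then: (1) the first-order dynamics $\dot x=-Gx$ are exponentially stable with rate $\min_i\Re(\lambda_i)$; (2) the dynamics $$\ddot x(t)+\frac{3}{t}\dot x(t)+Gx(t)=0,\qquad t\in[t_0,\infty),\quad x(t)\in\mathbb{R}^N,$$ are exponentially unstable; (3) generic modal data associated with $\lambda_j$ grow at rate $$|\mathrm{Im}(\sqrt{\lambda_j})|=\sqrt{\frac{\sqrt{a^2+b^2}-a}{2}}.$$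
   Context: $\sqrt{\lambda}$ is the square root with $\Re(\sqrt\lambda)\ge0$. Exponential stability of $\dot x=-Gx$ with rate $\rho$ means that there is a constant $C$ with $\|x(t)\|_2\le Ce^{-\rho (t-s)}\|x(s)\|_2$ for all $t\ge s$ and all solutions. Exponential instability of the second-order dynamics means that there exist arbitrarily small initial conditions $(x(t_0),\dot x(t_0))\in\mathbb{R}^{2N}$ for which $\|x(t)\|_2\ge c\,e^{\alpha t}$ for some $c,\alpha>0$ and all sufficiently large $t$. For a nonzero left eigenvector $w\in\mathbb{C}^N$, $w^*G=\lambda_jw^*$, the modal variable $y(t)=w^*x(t)$ satisfies the scalar equation $\ddot y+\frac{3}{t}\dot y+\lambda_j y=0$; its modal data are $(y(t_0),\dot y(t_0))\in\mathbb{C}^2$. ''Generic modal data grow at rate $\rho$'' means that for all $(y(t_0),\dot y(t_0))\in\mathbb{C}^2$ outside some one-dimensional complex subspace, the solution $y$ of this scalar equation satisfies $|y(t)|\to\infty$ and $\lim_{t\to\infty}\frac1t\log|y(t)|=\rho$. *)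

(* Defs.v *)
From HB Require Import structures.
From mathcomp Require Import all_boot all_order all_algebra.
From mathcomp Require Import complex.
From mathcomp Require Import all_classical all_reals all_analysis.

Set Implicit Arguments.
Unset Strict Implicit.
Unset Printing Implicit Defensive.

Import Order.TTheory GRing.Theory Num.Theory.
Import numFieldNormedType.Exports.

Local Open Scope classical_set_scope.
Local Open Scope ring_scope.
Local Open Scope complex_scope.

(* Derivative at [t] of a function considered on [s, +oo[ only: two-sided for
   s < t, and the right derivative at the end point t = s.  Values of [f]
   before [s] play no role. *)
Definition derivative_from (R : realType) (s : R) (f : R -> R) (t l : R) : Prop :=
  h^-1 * (f (t + h) - f t) @[h --> within [set h | s <= t + h] 0^'] --> l.

Definition derivative_from_cV (R : realType) (N : nat) (s : R)
    (f : R -> 'cV[R]_N) (t : R) (l : 'cV[R]_N) : Prop :=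
  forall i : 'I_N, derivative_from s (fun u => f u i 0) t (l i 0).

Definition derivative_from_C (R : realType) (s : R)
    (f : R -> R[i]) (t : R) (l : R[i]) : Prop :=
  derivative_from s (fun u => complex.Re (f u)) t (complex.Re l) /\
  derivative_from s (fun u => complex.Im (f u)) t (complex.Im l).

(* The library norm on matrices is the sup norm. *)
Definition norm2 (R : realType) (N : nat) (x : 'cV[R]_N) : R :=
  Num.sqrt (\sum_(i < N) x i 0 ^+ 2).

Definition first_order_solution (R : realType) (N : nat) (G : 'M[R]_N)
    (s : R) (x : R -> 'cV[R]_N) : Prop :=
  forall t, s <= t -> derivative_from_cV s x t (- (G *m x t)).

(* The initial time of a solution is arbitrary; [C] depends neither on it nor
   on the solution. *)
Definition exponentially_stable (R : realType) (N : nat) (G : 'M[R]_N)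
    (rho : R) : Prop :=
  exists C : R, forall (r : R) (x : R -> 'cV[R]_N),
    first_order_solution G r x ->
    forall s t, r <= s -> s <= t ->
      norm2 (x t) <= C * expR (- rho * (t - s)) * norm2 (x s).

Definition second_order_solution (R : realType) (N : nat) (G : 'M[R]_N)
    (t0 : R) (x0 v0 : 'cV[R]_N) (x : R -> 'cV[R]_N) : Prop :=
  exists v a : R -> 'cV[R]_N,
    [/\ x t0 = x0, v t0 = v0 &
        forall t, t0 <= t ->
          [/\ derivative_from_cV t0 x t (v t),
              derivative_from_cV t0 v t (a t) &
              a t + (3 / t) *: v t + G *m x t = 0]].

Definition exponentially_unstable (R : realType) (N : nat) (G : 'M[R]_N)
    (t0 : R) : Prop :=
  forall eps : R, 0 < eps ->
  exists x0 v0 : 'cV[R]_N,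
    [/\ norm2 (col_mx x0 v0) < eps,
        exists x, second_order_solution G t0 x0 v0 x &
        exists c alpha : R, [/\ 0 < c, 0 < alpha &
          forall x, second_order_solution G t0 x0 v0 x ->
            \forall t \near +oo, c * expR (alpha * t) <= norm2 (x t)]].

Definition modal_solution (R : realType) (lambda : R[i]) (t0 : R)
    (y0 y1 : R[i]) (y : R -> R[i]) : Prop :=
  exists v a : R -> R[i],
    [/\ y t0 = y0, v t0 = y1 &
        forall t, t0 <= t ->
          [/\ derivative_from_C t0 y t (v t),
              derivative_from_C t0 v t (a t) &
              a t + (3 / t)%:C * v t + lambda * y t = 0]].

(* [L] is a complex line in C^2.  [ComplexField.Normc.normc] is the modulus with
   values in [R]; the norm `|_| on R[i] takes its values in R[i]. *)
Definition generic_modal_growth (R : realType) (lambda : R[i]) (t0 rho : R) : Prop :=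
  exists2 L : {vspace (R[i]^o * R[i]^o)%type}, \dim L = 1%N &
    forall y0 y1 : R[i], (y0, y1) \notin L ->
      (exists y, modal_solution lambda t0 y0 y1 y) /\
      forall y, modal_solution lambda t0 y0 y1 y ->
        ComplexField.Normc.normc (y t) @[t --> +oo] --> +oo /\
        t^-1 * ln (ComplexField.Normc.normc (y t)) @[t --> +oo] --> rho.

(* Main.v *)
Require Import Defs.
From HB Require Import structures.
From mathcomp Require Import all_boot all_order all_algebra.
From mathcomp Require Import complex.
From mathcomp Require Import all_classical all_reals all_analysis.
From mathcomp Require Import ring lra.

(* Let k^2 = - lambda_j with Re k = rho = |Im (sqrt lambda_j)| > 0, and put
   B = Re (conj (k y) y') and F = |y'|^2 + |k y|^2, so that 2 B <= F.  The
   modal equation gives (t^3 B)' = rho t^3 F and F' <= 2 rho F.  If B is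
   positive at some time, then t^3 B grows at least like e^(2 rho t), F at most
   like e^(2 rho t), and B^2 <= |k y|^2 F squeezes |y| between multiples of
   t^-3 e^(rho t) and e^(rho t).  For two solutions y, z with B <= 0 forever,
   t^3 W is constant (W the Wronskian) and |k W|^2 <= F_y F_z, so W <> 0 would
   make t^3 (B_y + B_z) increase at least linearly, a contradiction; hence the
   data of such solutions lie on one complex line.
   Solutions exist for all data: the power series solution f at 0 has no zero
   on the positive axis because (t^3 Im (conj f f'))' = - Im lambda_j t^3 |f|^2
   has constant sign, and reduction of order gives a second solution.
   The unitary diagonalization of G yields x^T G x >= (min_i Re lambda_i) |x|^2,
   hence (1), and an eigenvector u and a left eigenvector v with v u = 1 and
   v conj(u) = 0, so that the real solution Re (y u) has modal variable y / 2;
   hence (2). *)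

Set Implicit Arguments.
Unset Strict Implicit.
Unset Printing Implicit Defensive.

Import Order.TTheory GRing.Theory Num.Theory.
Import numFieldNormedType.Exports.

Local Open Scope classical_set_scope.
Local Open Scope ring_scope.
Local Open Scope complex_scope.

(** * One-sided derivatives *)

Section DerivativeFrom.
Context {R : realType}.
Implicit Types (s t l c : R) (f g : R -> R).

Lemma derivative_from_eq s f t l l' :
  derivative_from s f t l -> l = l' -> derivative_from s f t l'.
Proof. by move=> + <-. Qed.

Lemma derivative_from_ext s f g t l :
  f =1 g -> derivative_from s f t l -> derivative_from s g t l.
Proof. by move=> /funext ->. Qed.

(** * Difference quotients along an arbitrary filter *)

Section Quotients.
Variables (F : set_system R) (FF : Filter F) (t : R).
Let quot f : R -> R := fun h => h^-1 * (f (t + h) - f t).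

(** Off h = 0, f (t + h) equals f t plus h times the quotient, and that product tends to 0 * l. *)
Lemma cvg_quotient_continuous f l : (id : R -> R) @ F --> 0 ->
  (\forall h \near F, (h : R) != 0) ->
  quot f @ F --> l -> (fun h : R => f (t + h)) @ F --> f t.
Proof.
move=> h0 hn0 df.
rewrite -[X in _ --> X]addr0 -[X in _ --> _ + X](mul0r l).
apply: cvg_trans (cvgD (cvg_cst (f t)) (cvgM h0 df)); apply: near_eq_cvg.
apply: filterS hn0 => h hn0; rewrite /quot /=.
by rewrite -[LHS]/(f t + h * (h^-1 * (f (t + h) - f t))); field.
Qed.

Lemma cvg_quotientD f g l l' :
  quot f @ F --> l -> quot g @ F --> l' ->
  quot (fun u => f u + g u) @ F --> l + l'.
Proof.
move=> df dg; apply: cvg_trans (cvgD df dg).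
apply: near_eq_cvg; apply: nearW => h.
by rewrite -[LHS]/(quot f h + quot g h) /quot; ring.
Qed.

(** The increment of f g is split as (increment of f) * g (t + h) + f t * (increment of g), which is
    why continuity is asked of g. *)
Lemma cvg_quotientM f g l l' : (fun h : R => g (t + h)) @ F --> g t ->
  quot f @ F --> l -> quot g @ F --> l' ->
  quot (fun u => f u * g u) @ F --> l * g t + f t * l'.
Proof.
move=> cg df dg; apply: cvg_trans (cvgD (cvgM df cg) (cvgM (cvg_cst (f t)) dg)).
apply: near_eq_cvg; apply: nearW => h.
by rewrite -[LHS]/(quot f h * g (t + h) + f t * quot g h) /quot; ring.
Qed.

Lemma cvg_quotient_cst c : quot (fun=> c) @ F --> 0.
Proof. by rewrite /quot subrr; under eq_fun do rewrite mulr0; exact: cvg_cst. Qed.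

End Quotients.

(** For t < s no small h is admissible and the filter is improper, so only [Filter] holds for all s
    and t. *)
Let derivative_from_filter s t :
  @Filter R (within [set h | s <= t + h] (0 : R)^').
Proof. exact: within_filter. Qed.

Lemma derivative_from_continuous s f t l : derivative_from s f t l ->
  f (t + h) @[h --> within [set h | s <= t + h] 0^'] --> f t.
Proof.
apply: (cvg_quotient_continuous (derivative_from_filter s t)).
  by apply: cvg_trans (@nbhs_dnbhs _ (0 : R)); apply: cvg_within.
by exists 1 => //= h _ ->.
Qed.

Lemma derivative_from_cst s c t : derivative_from s (fun=> c) t 0.
Proof. exact: (cvg_quotient_cst (derivative_from_filter s t)). Qed.

Lemma derivative_fromD s f g t l l' :
  derivative_from s f t l -> derivative_from s g t l' ->
  derivative_from s (fun u => f u + g u) t (l + l').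
Proof. exact: (cvg_quotientD (derivative_from_filter s t)). Qed.

Lemma derivative_fromM s f g t l l' :
  derivative_from s f t l -> derivative_from s g t l' ->
  derivative_from s (fun u => f u * g u) t (l * g t + f t * l').
Proof.
move=> df dg; apply: (cvg_quotientM (derivative_from_filter s t)) => //.
exact: derivative_from_continuous dg.
Qed.

Lemma derivative_from_widen s s' f t l :
  s <= s' -> derivative_from s f t l -> derivative_from s' f t l.
Proof.
move=> ss'; apply: cvg_trans => A /=; rewrite /nbhs/= /within/=.
by apply: filterS => h /[swap] s'h; apply; apply: le_trans s'h.
Qed.

Let quotientE f t : (fun h : R => h^-1 *: ((f \o shift t) (h *: 1) - f t)) =
  (fun h => h^-1 * (f (t + h) - f t)).
Proof.
by apply/funext => h /=; rewrite /GRing.scale/= mulr1 /shift/= (addrC h).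
Qed.

Lemma is_derive_derivative_from s f t l :
  is_derive t 1 f l -> derivative_from s f t l.
Proof.
case=> df dfl.
have : (fun h : R => h^-1 *: ((f \o shift t) (h *: 1) - f t)) @ 0^' --> l.
  by rewrite -dfl; exact: df.
rewrite quotientE; apply: cvg_trans.
by apply: cvg_app; exact: cvg_within.
Qed.

Lemma derivative_from_is_derive s f t l : s < t ->
  derivative_from s f t l -> is_derive t 1 f l.
Proof.
move=> st df.
have {}df : (fun h : R => h^-1 *: ((f \o shift t) (h *: 1) - f t)) @ 0^' --> l.
  rewrite quotientE; apply: cvg_trans df => A /=; rewrite /nbhs/= /within/=.
  move=> -[e /= e0 eA].
  (* For |h| < t - s the constraint s <= t + h is automatic, so the restricted limit is the
     two-sided one. *)
  exists (Num.min e (t - s)) => /=; first by rewrite lt_min e0 subr_gt0.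
  move=> h /=; rewrite sub0r normrN lt_min => /andP[he hts] h0.
  apply: (eA h) => //=; first by rewrite sub0r normrN.
  move: hts; rewrite ltr_norml; lra.
by split; [apply: cvgP df | apply: cvg_lim df].
Qed.

Lemma derivative_fromN s f t l :
  derivative_from s f t l -> derivative_from s (fun u => - f u) t (- l).
Proof.
move=> df; apply: derivative_from_eq (derivative_from_ext _
  (derivative_fromM (derivative_from_cst s (-1) t) df)) _ => [u|] /=; ring.
Qed.

Lemma derivative_from_id s t : derivative_from s id t 1.
Proof. exact: is_derive_derivative_from. Qed.

Lemma derivative_from_within_continuous s f t l : derivative_from s f t l ->
  f x @[x --> within [set x | s <= x] (nbhs t)] --> f t.
Proof.
move=> /derivative_from_continuous/cvgrPdist_lt cf.
apply/cvgrPdist_lt => e e0; have := cf e e0.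
rewrite !near_withinE => -[d /= d0 fd].
exists d => //= x; rewrite /ball_ => xd sx.
(* The punctured filter omits x = t, where the estimate is trivial. *)
have [->|xt] := eqVneq x t; first by rewrite subrr normr0.
have := fd (x - t); rewrite /= subrKC; apply => //.
  by rewrite sub0r opprB.
by rewrite subr_eq0.
Qed.

Section Monotony.
Variables (s : R) (f df : R -> R).
Hypothesis dfE : forall t, s <= t -> derivative_from s f t (df t).

(** Interior points have two-sided derivatives; at u, possibly equal to s, one-sided continuity is
    enough for continuity on the segment. *)
Lemma derivative_from_MVT u v : s <= u -> u < v ->
  exists2 c, c \in `]u, v[ & f v - f u = df c * (v - u).
Proof.
move=> su uv; apply: MVT => // [x|].
  rewrite in_itv/= => /andP[ux _].
  by apply: (@derivative_from_is_derive s); [|apply: dfE]; lra.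
apply/subspace_continuousP => x /=; rewrite in_itv/= => /andP[ux xv].
have := derivative_from_within_continuous (dfE (le_trans su ux)).
apply: cvg_trans => A /=; rewrite /nbhs/= /within/=.
apply: filterS => y yA; rewrite in_itv/= => /andP[uy _]; apply: yA; lra.
Qed.

Lemma derivative_from_ndecr : (forall t, s <= t -> 0 <= df t) ->
  forall u v, s <= u -> u <= v -> f u <= f v.
Proof.
move=> df0 u v su; rewrite le_eqVlt => /predU1P[->//|uv].
have [c] := derivative_from_MVT su uv; rewrite in_itv/= => /andP[uc cv] E.
rewrite -subr_ge0 E mulr_ge0 ?subr_ge0 ?df0; lra.
Qed.

End Monotony.

End DerivativeFrom.

(** * Energy estimates for the modal equation *)

Section MoreRules.
Context {R : realType}.
Implicit Types (s t c : R).

(** The form 3 / t * t^3 lets [ring] cancel it against the damping term 3 / t, with 1 / t as an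
    atom. *)
Lemma derivative_from_cube s t : t != 0 ->
  derivative_from s (fun u => u ^+ 3) t (3 / t * t ^+ 3).
Proof.
move=> t0; have d1 := derivative_from_id s t.
apply: derivative_from_eq (derivative_fromM d1 (derivative_fromM d1 d1)) _.
by field.
Qed.

Lemma derivative_from_expR s c t :
  derivative_from s (fun u => expR (c * u)) t (c * expR (c * t)).
Proof.
apply: is_derive_derivative_from.
have d1 : is_derive t (1 : R) (fun u => c * u) c.
  apply: (@derivative_from_is_derive _ (t - 1)); first lra.
  apply: derivative_from_eq (derivative_fromM (derivative_from_cst _ c _)
    (derivative_from_id _ _)) _.
  by ring.
have := @is_derive1_comp R expR (fun u => c * u) t _ _ (is_derive_expR _) d1.
by rewrite mulrC.
Qed.

End MoreRules.

(** Syntax-directed differentiation: the derivative is an evar introduced by [derivative_from_eq],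
    and atoms are closed by hypotheses in context. The cube rule also expects t != 0 there. *)
Ltac derivative_from_rules :=
  lazymatch goal with
  | |- derivative_from _ (fun=> ?c) _ _ => refine (@derivative_from_cst _ _ _ _)
  | |- derivative_from _ (fun u => u) _ _ => refine (@derivative_from_id _ _ _)
  | |- derivative_from _ (fun u => u ^+ 3) _ _ =>
      refine (derivative_from_cube _ _); assumption
  | |- derivative_from _ (fun u => expR (_ * u)) _ _ =>
      refine (@derivative_from_expR _ _ _ _)
  | |- derivative_from _ (fun u => _ + _) _ _ =>
      refine (derivative_fromD _ _); derivative_from_rules
  | |- derivative_from _ (fun u => - _) _ _ =>
      refine (derivative_fromN _); derivative_from_rules
  | |- derivative_from _ (fun u => _ * _) _ _ =>
      refine (derivative_fromM _ _); derivative_from_rules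
  | |- _ => eassumption
  end.

Section ReIm.
Context {R : realType}.
Local Notation Re := complex.Re.
Local Notation Im := complex.Im.
Implicit Types a b : R[i].

Lemma complex_ReD a b : Re (a + b) = Re a + Re b.
Proof. by case: a b => ? ? []. Qed.
Lemma complex_ImD a b : Im (a + b) = Im a + Im b.
Proof. by case: a b => ? ? []. Qed.
Lemma complex_ReN a : Re (- a) = - Re a.
Proof. by case: a. Qed.
Lemma complex_ImN a : Im (- a) = - Im a.
Proof. by case: a. Qed.
Lemma complex_ReM a b : Re (a * b) = Re a * Re b - Im a * Im b.
Proof. by case: a b => ? ? []. Qed.
Lemma complex_ImM a b : Im (a * b) = Re a * Im b + Im a * Re b.
Proof. by case: a b => ? ? []. Qed.

Definition ReImE := (complex_ReD, complex_ImD, complex_ReN, complex_ImN,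
  complex_ReM, complex_ImM).

End ReIm.

(** * Derivatives of the cross term and of the energy *)

Section Energy.
Context {R : realType}.
Variables (k : R[i]) (t0 : R).
Hypotheses (t0_gt0 : 0 < t0).
Local Notation Re := complex.Re.
Local Notation Im := complex.Im.

(** The modal equation as a first-order system, with -lambda written as k^2. *)
Definition modal_system (y v : R -> R[i]) := forall t, t0 <= t ->
  derivative_from_C t0 y t (v t) /\
  derivative_from_C t0 v t (k ^+ 2 * y t - (3 / t)%:C * v t).

(* With v in the role of y': cross is Re (conj (k y) v) and energy is
   |v|^2 + |k y|^2. *)
Definition cross (y v : R[i]) : R :=
  (Re k * Re y - Im k * Im y) * Re v + (Re k * Im y + Im k * Re y) * Im v.

Definition energy (y v : R[i]) : R :=
  Re v * Re v + Im v * Im v +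
  (Re k * Re k + Im k * Im k) * (Re y * Re y + Im y * Im y).

(** The difference is |v - k y|^2. *)
Lemma cross_le_energy y v : 2 * cross y v <= energy y v.
Proof.
rewrite -subr_ge0; set d := (X in 0 <= X).
have -> : d = (Re v - (Re k * Re y - Im k * Im y)) ^+ 2 +
              (Im v - (Re k * Im y + Im k * Re y)) ^+ 2.
  by rewrite /d /cross /energy; ring.
by rewrite addr_ge0 ?sqr_ge0.
Qed.

Section OneSolution.
Variables (y v : R -> R[i]).
Hypothesis yv : modal_system y v.

(** The factor t^3 absorbs the damping. What remains is Re (conj (k v) v + conj (k y) k^2 y), that
    is, Re k times the energy. *)
Lemma cube_cross_derivative t : t0 <= t ->
  derivative_from t0 (fun u => u ^+ 3 * cross (y u) (v u)) t
    (Re k * (t ^+ 3 * energy (y t) (v t))).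
Proof.
move=> tt; have [[yR yI] [vR vI]] := yv tt.
have tn0 := lt0r_neq0 (lt_le_trans t0_gt0 tt).
rewrite /cross; apply: derivative_from_eq; first by derivative_from_rules.
rewrite /energy expr2 !ReImE/=.
ring.
Qed.

(** The two mixed terms combine through k + conj k = 2 Re k into 4 Re k times the cross term;
    damping contributes -6 / t |v|^2. *)
Lemma energy_expR_derivative c t : t0 <= t ->
  derivative_from t0 (fun u => energy (y u) (v u) * expR (c * u)) t
    ((c * energy (y t) (v t) + 4 * Re k * cross (y t) (v t)
      - 6 / t * (Re (v t) * Re (v t) + Im (v t) * Im (v t))) * expR (c * t)).
Proof.
move=> tt; have [[yR yI] [vR vI]] := yv tt.
rewrite /energy; apply: derivative_from_eq; first by derivative_from_rules.
rewrite /cross expr2 !ReImE/=.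
ring.
Qed.

End OneSolution.
End Energy.

(** * Exponential bounds, and rigidity of the solutions that do not grow *)

Section Growth.
Context {R : realType}.
Variables (k : R[i]) (rho t0 : R).
Hypotheses (t0_gt0 : 0 < t0).
Local Notation Re := complex.Re.
Local Notation Im := complex.Im.
Hypotheses (rhoE : Re k = rho) (rho_gt0 : 0 < rho).
Let t_gt0 t : t0 <= t -> 0 < t. Proof. exact: lt_le_trans. Qed.
Let rho_ge0 : 0 <= rho. Proof. exact: ltW. Qed.
Local Notation sqn z := (Re z * Re z + Im z * Im z).

(** The right side is |k y|^2 |v|^2 + |k y|^4, and |k y|^2 |v|^2 is the square of the cross term
    plus that of Im (conj (k y) v). *)
Lemma cross_sqr_le y v : cross k y v ^+ 2 <= sqn k * sqn y * energy k y v.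
Proof.
rewrite -subr_ge0; set d := (X in 0 <= X).
have -> : d = ((Re k * Re y - Im k * Im y) * Im v -
    (Re k * Im y + Im k * Re y) * Re v) ^+ 2 + (sqn k * sqn y) ^+ 2.
  by rewrite /d /cross /energy; ring.
by rewrite addr_ge0 ?sqr_ge0.
Qed.

Lemma sqn_le_energy y v : sqn k * sqn y <= energy k y v.
Proof. by rewrite /energy lerDr addr_ge0 // -expr2 sqr_ge0. Qed.

Lemma energy_ge0 y v : 0 <= energy k y v.
Proof.
by rewrite /energy addr_ge0 // ?mulr_ge0 // addr_ge0 // -expr2 sqr_ge0.
Qed.

Definition wronskian (y v z w : R[i]) := y * w - v * z.

Lemma wronskian_le y v z w :
  sqn k * sqn (wronskian y v z w) <= energy k y v * energy k z w.
Proof.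
rewrite -subr_ge0; set d := (X in 0 <= X).
(* Lagrange's identity for the pairs (k y, - v) and (w, k z). *)
pose Y := k * y; pose Z := k * z.
have -> : d = (Re Y * Re Z + Im Y * Im Z + Re v * Re w + Im v * Im w) ^+ 2 +
   (Im Y * Re Z - Re Y * Im Z + Im v * Re w - Re v * Im w) ^+ 2.
  by rewrite /d /Y /Z /wronskian /energy !ReImE; ring.
by rewrite addr_ge0 ?sqr_ge0.
Qed.

Section OneSolution.
Variables (y v : R -> R[i]).
Hypothesis yv : modal_system k t0 y v.

Lemma cross_exponential s : t0 <= s -> 0 < cross k (y s) (v s) ->
  exists2 c, 0 < c &
    forall t, s <= t -> c * expR (2 * rho * t) <= t ^+ 3 * cross k (y t) (v t).
Proof.
move=> ts Bs.
(* With B the cross term and F the energy, g' = rho t^3 (F - 2 B) e^(-2 rho t), which is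
   nonnegative. *)
pose g t := t ^+ 3 * cross k (y t) (v t) * expR (- (2 * rho) * t).
have gmono u w : t0 <= u -> u <= w -> g u <= g w.
  apply: (@derivative_from_ndecr _ t0 g (fun t => (rho * t ^+ 3 *
      (energy k (y t) (v t) - 2 * cross k (y t) (v t))) * expR (- (2 * rho) * t))).
    move=> t tt; apply: derivative_from_eq (derivative_fromM
      (cube_cross_derivative t0_gt0 yv tt) (@derivative_from_expR _ _ _ _)) _.
    by rewrite rhoE; ring.
  move=> t tt; rewrite mulr_ge0 ?expR_ge0 // mulr_ge0 //.
    by rewrite mulr_ge0 ?exprn_ge0 // ltW // t_gt0.
  by rewrite subr_ge0 cross_le_energy.
exists (g s).
  by rewrite /g mulr_gt0 ?expR_gt0 // mulr_gt0 // exprn_gt0 // t_gt0.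
move=> t st; have h := gmono s t ts st.
rewrite -(ler_pM2r (expR_gt0 (2 * rho * t))) in h; apply: le_trans h _.
by rewrite -[leLHS]mulrA -expRD mulNr addNr expR0 mulr1.
Qed.

Lemma energy_exponential :
  exists2 C, 0 < C &
    forall t, t0 <= t -> energy k (y t) (v t) <= C * expR (2 * rho * t).
Proof.
pose g t := energy k (y t) (v t) * expR (- (2 * rho) * t).
have gmono t : t0 <= t -> g t <= g t0.
  move=> tt; rewrite -lerN2.
  (* Up to the exponential factor, D is -g'; both of its summands are nonnegative. *)
  pose D t := 2 * rho * (energy k (y t) (v t) - 2 * cross k (y t) (v t)) +
      6 / t * sqn (v t).
  apply: (@derivative_from_ndecr _ t0 (fun t => - g t)
     (fun t => D t * expR (- (2 * rho) * t))) => // {tt}[|{}t tt].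
    move=> u tu; have dg := energy_expR_derivative (c := - (2 * rho)) yv tu.
    apply: derivative_from_eq (derivative_fromN dg) _.
    by rewrite rhoE /D; ring.
  rewrite mulr_ge0 ?expR_ge0 // addr_ge0 //.
    by rewrite mulr_ge0 ?subr_ge0 ?cross_le_energy // mulr_ge0.
  by rewrite mulr_ge0 ?addr_ge0 -?expr2 ?sqr_ge0 // divr_ge0 // ltW // t_gt0.
(* The summand 1 keeps the constant positive for the zero solution. *)
exists (g t0 + 1).
  by rewrite ltr_wpDl // mulr_ge0 ?expR_ge0 ?energy_ge0.
move=> t tt; have h := gmono t tt.
rewrite -(ler_pM2r (expR_gt0 (2 * rho * t))) in h.
rewrite -[leLHS]mulrA -expRD mulNr addNr expR0 mulr1 in h; apply: le_trans h _.
by rewrite ler_pM2r ?expR_gt0 // lerDl.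
Qed.

Lemma modulus_exponential s : t0 <= s -> 0 < cross k (y s) (v s) ->
  exists c C, [/\ 0 < c, 0 < C & forall t, s <= t ->
    c * expR (rho * t) <= t ^+ 3 * ComplexField.Normc.normc (y t) /\
    ComplexField.Normc.normc (y t) <= C * expR (rho * t)].
Proof.
move=> ts Bs; have [c c0 cP] := cross_exponential ts Bs.
have [C C0 CP] := energy_exponential.
have k0 : 0 < sqn k.
  by rewrite ltr_wpDr -?expr2 ?sqr_ge0 // exprn_gt0 // rhoE.
have normcE (z : R[i]) : ComplexField.Normc.normc z = Num.sqrt (sqn z).
  by case: z => ? ?; rewrite /= !expr2.
have exp2 t : expR (2 * rho * t) = expR (rho * t) ^+ 2.
  by rewrite -expRM_natl; congr expR; ring.
(* The upper constant comes from |k y|^2 <= F <= C e^(2 rho t), the lower one from c e^(2 rho t) <=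
   t^3 B and B^2 <= |k y|^2 F. *)
exists (c / Num.sqrt (sqn k * C)), (Num.sqrt (C / sqn k)).
split; rewrite ?divr_gt0 ?sqrtr_gt0 ?mulr_gt0 ?invr_gt0 // => t st.
have tt : t0 <= t by exact: le_trans st.
have tt0 := t_gt0 tt.
have sy0 : 0 <= sqn (y t) by rewrite addr_ge0 // -expr2 sqr_ge0.
have E0 := expR_gt0 (rho * t).
rewrite normcE; split; last first.
  rewrite -[expR _]ger0_norm ?expR_ge0 // -sqrtr_sqr -sqrtrM; last first.
    by rewrite divr_ge0 // ltW.
  rewrite ler_sqrt ?mulr_ge0 ?sqr_ge0 ?invr_ge0 ?(ltW k0) ?(ltW C0) //.
  rewrite mulrAC ler_pdivlMr // mulrC -exp2.
  exact: le_trans (sqn_le_energy _ _) (CP t tt).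
rewrite mulrAC ler_pdivrMr ?sqrtr_gt0 ?mulr_gt0 //.
rewrite -mulrA -sqrtrM //.
have -> : t ^+ 3 * Num.sqrt (sqn (y t) * (sqn k * C)) =
    Num.sqrt ((t ^+ 3) ^+ 2 * (sqn (y t) * (sqn k * C))).
  by rewrite [RHS]sqrtrM ?sqr_ge0 // sqrtr_sqr ger0_norm // exprn_ge0 // ltW.
rewrite -[leLHS]ger0_norm; last by rewrite mulr_ge0 ?ltW.
rewrite -sqrtr_sqr ler_sqrt; last first.
  by rewrite mulr_ge0 ?sqr_ge0 // mulr_ge0 // ltW // mulr_gt0.
(* Multiplying by e^(2 rho t) turns the left side into (c e^(2 rho t))^2, which (t^3 B)^2
   dominates. *)
rewrite -(ler_pM2r (exprn_gt0 2 E0)).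
have h1 : (c * expR (rho * t) ^+ 2) ^+ 2 <= (t ^+ 3 * cross k (y t) (v t)) ^+ 2.
  have h0 := cP t st; rewrite exp2 in h0.
  have h : 0 <= c * expR (rho * t) ^+ 2 by rewrite mulr_ge0 ?sqr_ge0 // ltW.
  by rewrite ler_pXn2r ?nnegrE // (le_trans h h0).
rewrite [leLHS](_ : _ = (c * expR (rho * t) ^+ 2) ^+ 2); last by ring.
apply: le_trans h1 _; rewrite [leLHS]exprMn -[leRHS]mulrA ler_pM2l ?exprn_gt0 //.
apply: le_trans (cross_sqr_le _ _) _.
rewrite [leRHS](_ : _ = sqn k * sqn (y t) * (C * expR (2 * rho * t))); last first.
  by rewrite exp2; ring.
by rewrite ler_wpM2l ?CP // mulr_ge0 ?(ltW k0).
Qed.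

End OneSolution.

Lemma wronskian_nonpositive_cross (y v z w : R -> R[i]) :
  modal_system k t0 y v -> modal_system k t0 z w ->
  (forall t, t0 <= t -> cross k (y t) (v t) <= 0) ->
  (forall t, t0 <= t -> cross k (z t) (w t) <= 0) ->
  wronskian (y t0) (v t0) (z t0) (w t0) = 0.
Proof.
move=> yv zw yB zB.
pose W t := wronskian (y t) (v t) (z t) (w t).
(* Abel's identity: W' = -(3 / t) W, so t^3 W is constant. *)
have WR t : t0 <= t ->
    derivative_from t0 (fun u => u ^+ 3 * Re (W u)) t 0 /\
    derivative_from t0 (fun u => u ^+ 3 * Im (W u)) t 0.
  move=> tt; have [[yR yI] [vR vI]] := yv t tt.
  have [[zR zI] [wR wI]] := zw t tt.
  have tn0 := lt0r_neq0 (lt_le_trans t0_gt0 tt).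
  have WE u : Re (W u) = Re (y u) * Re (w u) - Im (y u) * Im (w u)
      - (Re (v u) * Re (z u) - Im (v u) * Im (z u)) /\
      Im (W u) = Re (y u) * Im (w u) + Im (y u) * Re (w u)
      - (Re (v u) * Im (z u) + Im (v u) * Re (z u)).
    by rewrite /W /wronskian !ReImE.
  split; (apply: derivative_from_ext;
    [by move=> u; rewrite ?(WE u).1 ?(WE u).2; reflexivity|]);
    (apply: derivative_from_eq; first by derivative_from_rules);
    rewrite expr2 !ReImE/=; ring.
have Wcst t : t0 <= t -> sqn (W t) * t ^+ 6 = sqn (W t0) * t0 ^+ 6.
  move=> tt.
  have cst f : (forall t, t0 <= t -> derivative_from t0 f t 0) -> f t = f t0.
    move=> df; apply/eqP; rewrite eq_le; apply/andP; split.
      rewrite -lerN2.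
      apply: (@derivative_from_ndecr _ t0 (fun u => - f u) (fun=> 0)) => //.
      by move=> u tu; rewrite -oppr0; apply: derivative_fromN; exact: df.
    by apply: (@derivative_from_ndecr _ t0 f (fun=> 0)).
  have eR := cst _ (fun u tu => (WR u tu).1).
  have eI := cst _ (fun u tu => (WR u tu).2).
  rewrite [LHS](_ : _ = (t ^+ 3 * Re (W t)) * (t ^+ 3 * Re (W t)) +
    (t ^+ 3 * Im (W t)) * (t ^+ 3 * Im (W t))); last by ring.
  by rewrite eR eI; ring.
apply/eqP; apply: contraT => W0.
(* m = 2 |k| |W t0| t0^3; since 4 F_y F_z <= (F_y + F_z)^2, it bounds t^3 (F_y + F_z) from below. *)
pose m := Num.sqrt (4 * sqn k * sqn (W t0) * t0 ^+ 6).
have k0 : 0 < sqn k.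
  by rewrite ltr_wpDr -?expr2 ?sqr_ge0 // exprn_gt0 // rhoE.
have sW0 : 0 < sqn (W t0).
  rewrite lt_neqAle eq_sym addr_ge0 -?expr2 ?sqr_ge0 // andbT.
  rewrite paddr_eq0 ?sqr_ge0 // !sqrf_eq0 -/(W t0).
  by move: W0; rewrite -/(W t0); case: (W t0) => p q; rewrite eq_complex.
have m0 : 0 < m by rewrite sqrtr_gt0 !mulr_gt0 // exprn_gt0.
pose F t := energy k (y t) (v t) + energy k (z t) (w t).
have FP t : t0 <= t -> m <= t ^+ 3 * F t.
  move=> tt; have t3 : 0 <= t ^+ 3 by rewrite exprn_ge0 // ltW // (lt_le_trans t0_gt0).
  have F0 : 0 <= F t by rewrite addr_ge0 ?energy_ge0.
  rewrite -[leRHS]ger0_norm; last by rewrite mulr_ge0.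
  rewrite -sqrtr_sqr ler_sqrt ?sqr_ge0 //.
  rewrite -mulrA -(Wcst t tt) [leLHS](_ : _ =
    t ^+ 3 ^+ 2 * (4 * (sqn k * sqn (W t)))); last by ring.
  rewrite [leRHS]exprMn ler_wpM2l ?sqr_ge0 //.
  have := wronskian_le (y t) (v t) (z t) (w t); rewrite -/(W t) => h.
  have : 4 * (sqn k * sqn (W t)) <= 4 * (energy k (y t) (v t) * energy k (z t) (w t)).
    by rewrite ler_pM2l.
  move/le_trans; apply; rewrite -subr_ge0.
  rewrite [X in 0 <= X](_ : _ = (energy k (y t) (v t) - energy k (z t) (w t)) ^+ 2).
    exact: sqr_ge0.
  by rewrite /F; ring.
(* S' = rho (t^3 F - m) >= 0, while nonpositive cross terms force S t <= - rho m t. *)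
pose S t := t ^+ 3 * cross k (y t) (v t) + t ^+ 3 * cross k (z t) (w t) - rho * m * t.
have Smono t : t0 <= t -> S t0 <= S t.
  move=> tt; apply: (@derivative_from_ndecr _ t0 S
    (fun t => rho * (t ^+ 3 * F t - m))) => // {tt}[|{}t tt].
    move=> u tu; apply: derivative_from_eq (derivative_fromD (derivative_fromD
      (cube_cross_derivative t0_gt0 yv tu) (cube_cross_derivative t0_gt0 zw tu))
      (derivative_fromN (derivative_fromM (derivative_from_cst _ _ _)
         (derivative_from_id _ _)))) _.
    by rewrite rhoE /F; ring.
  by rewrite mulr_ge0 ?subr_ge0 ?FP // ltW.
have Sle t : t0 <= t -> S t <= - (rho * m * t).
  move=> tt; have t3 : 0 <= t ^+ 3 by rewrite exprn_ge0 // ltW // (lt_le_trans t0_gt0).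
  rewrite /S gerDr; apply: le_trans (lerD (mulr_ge0_le0 t3 (yB t tt))
    (mulr_ge0_le0 t3 (zB t tt))) _.
  by rewrite addr0.
have rm0 : 0 < rho * m by rewrite mulr_gt0.
(* At this time - rho m T = - |S t0| - rho m t0, strictly below S t0. *)
pose T := t0 + `|S t0| / (rho * m).
have tT : t0 <= T by rewrite lerDl divr_ge0 // ltW.
have := le_trans (Smono T tT) (Sle T tT).
rewrite /T mulrDr mulrC [_ * (_ / _)]mulrC divfK ?gt_eqF //.
have := ler_norm (- S t0); rewrite normrN => h1 h2.
have : 0 < t0 * (rho * m) by rewrite mulr_gt0.
move=> h3; have : S t0 <= S t0 - t0 * (rho * m).
  by apply: le_trans h2 _; rewrite opprD addrC lerD2r lerNl.
by rewrite lerDl oppr_ge0 leNgt h3.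
Qed.

End Growth.

(** * Generic growth *)

Section LogGrowth.
Context {R : realType}.

Lemma ln_growth_rate (n : R -> R) (rho c C s : R) : 0 < c -> 0 < C ->
  (forall t, s <= t -> c * expR (rho * t) <= t ^+ 3 * n t /\
                       n t <= C * expR (rho * t)) ->
  t^-1 * ln (n t) @[t --> +oo] --> rho.
Proof.
move=> c0 C0 nP; apply/cvgrPdist_le => e e0.
(* From ln (t d) <= t d the polynomial loss satisfies 3 ln t <= t e / 2 - 3 ln d; the other half of
   t e absorbs the constants. *)
pose d := e / 6; have d0 : 0 < d by rewrite divr_gt0.
near=> t.
have st : s <= t by near: t; apply: nbhs_pinfty_ge; rewrite num_real.
have t0 : 0 < t by near: t; apply: nbhs_pinfty_gt; rewrite num_real.
have t1 : ln C / e <= t by near: t; apply: nbhs_pinfty_ge; rewrite num_real.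
have t2 : 2 * (- 3 * ln d - ln c) / e <= t.
  by near: t; apply: nbhs_pinfty_ge; rewrite num_real.
have [lo up] := nP t st.
have E0 := expR_gt0 (rho * t).
have n0 : 0 < n t.
  by rewrite -(pmulr_rgt0 _ (exprn_gt0 3 t0)) (lt_le_trans _ lo) // mulr_gt0 //.
have {}up : ln (n t) <= ln C + rho * t.
  by rewrite -[X in _ + X]expRK -lnM ?posrE // ler_ln ?posrE ?mulr_gt0 //.
have {}lo : ln c + rho * t <= 3 * ln t + ln (n t).
  rewrite -[X in _ + X <= _]expRK -lnM ?posrE // mulr_natl -lnXn //.
  by rewrite -lnM ?posrE ?exprn_gt0 // ler_ln ?posrE ?mulr_gt0 ?exprn_gt0 //.
have lt : ln t + ln d <= t * d.
  by rewrite -lnM ?posrE // ltW // ln_sublinear // mulr_gt0 //.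
rewrite ler_pdivrMr // in t1; rewrite ler_pdivrMr // in t2.
have dE : t * d = t * e / 6 by rewrite /d mulrA.
have -> : rho - t^-1 * ln (n t) = (rho * t - ln (n t)) / t.
  by field; apply: lt0r_neq0.
rewrite normrM normfV (gtr0_norm t0) ler_pdivrMr // ler_norml.
by apply/andP; split; lra.
Unshelve. all: by end_near. Qed.

Lemma pinfty_growth (n : R -> R) (rho c C s : R) : 0 < c -> 0 < C -> 0 < rho ->
  (forall t, s <= t -> c * expR (rho * t) <= t ^+ 3 * n t /\
                       n t <= C * expR (rho * t)) ->
  n t @[t --> +oo] --> +oo.
Proof.
move=> c0 C0 rho0 nP; have := ln_growth_rate c0 C0 nP.
have r2 : 0 < rho / 2 by rewrite divr_gt0.
move/cvgrPdist_le => /(_ _ r2) nr.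
apply/cvgryPge => A; near=> t.
have t0 : 0 < t by near: t; apply: nbhs_pinfty_gt; rewrite num_real.
have tA : A / (rho / 2) <= t by near: t; apply: nbhs_pinfty_ge; rewrite num_real.
have st : s <= t by near: t; apply: nbhs_pinfty_ge; rewrite num_real.
have : `|rho - t^-1 * ln (n t)| <= rho / 2 by near: t.
rewrite ler_norml => /andP[_ h].
have n0 : 0 < n t.
  rewrite -(pmulr_rgt0 _ (exprn_gt0 3 t0)) (lt_le_trans _ (nP t st).1) //.
  by rewrite mulr_gt0 ?expR_gt0 //.
(* As n >= ln n, it suffices that ln n >= t rho / 2 >= A. *)
apply: (le_trans _ (ltW (ln_sublinear n0))).
rewrite ler_pdivrMr // in tA; apply: le_trans tA _.
have {}h : rho / 2 <= t^-1 * ln (n t) by lra.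
by rewrite ler_pdivlMl // in h.
Unshelve. all: by end_near. Qed.

End LogGrowth.

(** * The exceptional line of modal data *)

Section Generic.
Context {R : realType}.
Local Notation Re := complex.Re.
Local Notation Im := complex.Im.

Lemma modal_solution_system (lambda k : R[i]) (t0 : R) y0 y1 y :
  k ^+ 2 = - lambda -> modal_solution lambda t0 y0 y1 y ->
  exists v, [/\ y t0 = y0, v t0 = y1 & modal_system k t0 y v].
Proof.
move=> kE [v [a [yE vE yP]]]; exists v; split => // t tt.
have [dy dv E] := yP t tt; split => //.
suff -> : k ^+ 2 * y t - (3 / t)%:C * v t = a t by [].
rewrite kE; apply/eqP; rewrite -subr_eq0 -oppr_eq0 -E; apply/eqP; ring.
Qed.

Local Notation data := (R[i]^o * R[i]^o)%type.

Lemma wronskian_eq0_line (v0 v1 y0 y1 : R[i]) : (v0, v1) != 0 ->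
  wronskian v0 v1 y0 y1 = 0 ->
  ((y0, y1) : data) \in <[((v0, v1) : data)]>%VS.
Proof.
move=> v_neq0 /eqP; rewrite /wronskian subr_eq0 => /eqP W.
apply/vlineP; have [v00|v0_neq0] := eqVneq v0 0.
  have v1_neq0 : v1 != 0 by move: v_neq0; rewrite v00 xpair_eqE eqxx.
  exists (y1 / v1); congr (_, _).
    move/eqP: W; rewrite v00 mul0r eq_sym mulf_eq0 (negPf v1_neq0) => /eqP ->.
    by rewrite /GRing.scale/= mulr0.
  by rewrite /GRing.scale/= divfK.
exists (y0 / v0); congr (_, _); rewrite /GRing.scale/= ?divfK //.
by apply: (mulfI v0_neq0); rewrite W; field.
Qed.

Lemma generic_modal_growth_of_existence (lambda k : R[i]) (t0 : R) :
  0 < t0 -> 0 < Re k -> k ^+ 2 = - lambda ->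
  (forall y0 y1, exists y, modal_solution lambda t0 y0 y1 y) ->
  generic_modal_growth lambda t0 (Re k).
Proof.
move=> t0_gt0 k_gt0 kE ex.
(* Once L contains these data, every solution with data outside L has a positive cross term at some
   time. *)
pose nongrowing (d : data) := exists y v, [/\ y t0 = d.1, v t0 = d.2,
  modal_system k t0 y v & forall t, t0 <= t -> cross k (y t) (v t) <= 0].
have [L dimL LP] : exists2 L : {vspace data}, \dim L = 1%N &
    forall d, nongrowing d -> d \in L.
  have [[[v0 v1] v_neq0 [y [v [/= yE vE yv By]]]]|no] :=
      pselect (exists2 d, d != 0 & nongrowing d); last first.
    (* If only the zero data can fail to grow, any line serves as L. *)
    exists <[((1, 0)%R : data)]>%VS; first by rewrite dim_vline xpair_eqE oner_eq0.
    move=> d nd; have [->|dn0] := eqVneq d 0; first exact: mem0v.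
    by case: no; exists d.
  exists <[((v0, v1) : data)]>%VS; first by rewrite dim_vline v_neq0.
  move=> [z0 z1] [z [w [/= zE wE zw Bz]]].
  apply: (wronskian_eq0_line v_neq0); rewrite -yE -vE -zE -wE.
  exact: (wronskian_nonpositive_cross t0_gt0 erefl k_gt0 yv zw By Bz).
exists L => // y0 y1 yL; split=> // y /(modal_solution_system kE)[v [yE vE yv]].
have [s ts Bs] : exists2 s, t0 <= s & 0 < cross k (y s) (v s).
  apply: contrapT => no; move/negP: yL; apply; apply: LP.
  exists y, v; split => // t tt; rewrite leNgt; apply/negP => Bt.
  by apply: no; exists t.
have [c [C [c0 C0 cC]]] := modulus_exponential t0_gt0 erefl k_gt0 yv ts Bs.
by split; [exact: pinfty_growth cC | exact: ln_growth_rate cC].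
Qed.

End Generic.

(** * Existence of modal solutions *)

Section ComplexRules.
Context {R : realType}.
Local Notation Re := complex.Re.
Local Notation Im := complex.Im.
Implicit Types (s t : R) (f g : R -> R[i]) (l : R[i]).

Lemma derivative_fromV s (f : R -> R) t (l : R) : s < t -> f t != 0 ->
  derivative_from s f t l ->
  derivative_from s (fun u => (f u)^-1) t (- l / f t ^+ 2).
Proof.
move=> st ft0 /(derivative_from_is_derive st) df.
apply: is_derive_derivative_from; apply: is_derive_eq (is_deriveV ft0 df) _.
by rewrite /GRing.scale/= mulrC mulNr mulrN.
Qed.

Lemma derivative_from_C_eq s f t l l' :
  derivative_from_C s f t l -> l = l' -> derivative_from_C s f t l'.
Proof. by move=> + <-. Qed.

Lemma derivative_from_C_widen s s' f t l :
  s <= s' -> derivative_from_C s f t l -> derivative_from_C s' f t l.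
Proof. by move=> ss' [? ?]; split; apply: derivative_from_widen ss' _. Qed.

Lemma derivative_from_C_cst s (c : R[i]) t : derivative_from_C s (fun=> c) t 0.
Proof. by split; apply: derivative_from_cst. Qed.

Lemma derivative_from_C_real s (f : R -> R) t (l : R) :
  derivative_from s f t l -> derivative_from_C s (fun u => (f u)%:C) t l%:C.
Proof. by move=> df; split => //=; exact: derivative_from_cst. Qed.

Lemma derivative_from_CD s f g t l l' :
  derivative_from_C s f t l -> derivative_from_C s g t l' ->
  derivative_from_C s (fun u => f u + g u) t (l + l').
Proof.
move=> [fR fI] [gR gI]; split.
  apply: derivative_from_ext (fun u => esym (complex_ReD _ _)) _.
  by rewrite complex_ReD; exact: derivative_fromD.
apply: derivative_from_ext (fun u => esym (complex_ImD _ _)) _.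
by rewrite complex_ImD; exact: derivative_fromD.
Qed.

Lemma derivative_from_CM s f g t l l' :
  derivative_from_C s f t l -> derivative_from_C s g t l' ->
  derivative_from_C s (fun u => f u * g u) t (l * g t + f t * l').
Proof.
move=> [fR fI] [gR gI]; split.
  apply: derivative_from_ext (fun u => esym (complex_ReM _ _)) _.
  apply: derivative_from_eq; first by derivative_from_rules.
  by rewrite !ReImE; ring.
apply: derivative_from_ext (fun u => esym (complex_ImM _ _)) _.
apply: derivative_from_eq; first by derivative_from_rules.
by rewrite !ReImE; ring.
Qed.

Let ReV (z : R[i]) : Re z^-1 = Re z * (Re z * Re z + Im z * Im z)^-1.
Proof. by case: z => a b; rewrite /= !expr2. Qed.
Let ImV (z : R[i]) : Im z^-1 = - Im z * (Re z * Re z + Im z * Im z)^-1.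
Proof. by case: z => a b; rewrite /= !expr2 mulNr. Qed.

(** Via 1 / f = conj f / |f|^2, the rule reduces to the real reciprocal of |f|^2. *)
Lemma derivative_from_CV s f t l : s < t -> f t != 0 ->
  derivative_from_C s f t l ->
  derivative_from_C s (fun u => (f u)^-1) t (- l / f t ^+ 2).
Proof.
move=> st f0 [fR fI].
have n0 : Re (f t) * Re (f t) + Im (f t) * Im (f t) != 0.
  move: f0; case: (f t) => a b; rewrite eq_complex /= -!expr2 => f0.
  by rewrite paddr_eq0 ?sqr_ge0 // !sqrf_eq0.
have dn := derivative_fromV st n0
  (derivative_fromD (derivative_fromM fR fR) (derivative_fromM fI fI)).
split.
  apply: derivative_from_ext (fun u => esym (ReV _)) _.
  apply: derivative_from_eq; first by derivative_from_rules.
  rewrite [in RHS]expr2 [in RHS]invfM !(ReImE, ReV, ImV); clear -n0.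
  by move: (Re _) (Im _) (Re l) (Im l) n0 => p q lr li n0; field.
apply: derivative_from_ext (fun u => esym (ImV _)) _.
apply: derivative_from_eq; first by derivative_from_rules.
rewrite [in RHS]expr2 [in RHS]invfM !(ReImE, ReV, ImV); clear -n0.
by move: (Re _) (Im _) (Re l) (Im l) n0 => p q lr li n0; field.
Qed.

End ComplexRules.

(** * Antiderivatives of continuous functions *)

Section Antiderivative.
Context {R : realType}.

Lemma continuous_antiderivative (g : R -> R) (a : R) :
  (forall t, a <= t -> {for t, continuous g}) ->
  exists G, forall t, a < t -> is_derive t 1 G (g t).
Proof.
move=> cg; pose mu := @lebesgue_measure R.
exists (fun x => \int[mu]_(t in [set` `[a, x]]) g t)%R => t ta.
(* The endpoint t + 1 makes t an interior point of the segment. *)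
have : mu.-integrable `[a, t + 1] (EFin \o g).
  apply: continuous_compact_integrable; first exact: segment_compact.
  apply/subspace_continuousP => x /=; rewrite in_itv/= => /andP[ax _].
  by apply: cvg_within_filter; exact: cg.
move=> ig; have tu : t < t + 1 by rewrite ltrDl.
have [dG GE] := continuous_FTC1_closed tu ig ta (cg t (ltW ta)).
by apply: DeriveDef; [exact: dG | rewrite -derive1E].
Qed.

End Antiderivative.

(** * Power series with infinite radius of convergence *)

Section EntireSeries.
Context {R : realType}.
Implicit Types (u w : R^nat) (x : R).

(** Domination by the coefficients of A e^(B x): this gives convergence everywhere and is stable
    under sums, shifts and termwise derivation. *)
Definition entire u := exists A B : R, [/\ 0 <= A, 0 <= B &
  forall n, `|u n| <= A * (B ^+ n / n`!%:R)].

Definition psum u x : R := limn (pseries u x).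

Lemma entire_cvg u x : entire u -> cvgn (pseries u x).
Proof.
move=> [A [B [A0 B0 uAB]]]; apply: normed_cvg.
apply: (@series_le_cvg _ _ (A *: exp_coeff (B * `|x|))).
- by move=> n /=.
- by move=> n; rewrite /GRing.scale/= mulr_ge0 // exp_coeff_ge0 // mulr_ge0.
- move=> n /=; rewrite normrM normrX.
  apply: le_trans (ler_wpM2r _ (uAB n)) _; first by rewrite exprn_ge0.
  by rewrite /GRing.scale/= /exp_coeff/= exprMn -!mulrA [_^-1 * _]mulrC.
- by apply: is_cvg_seriesZ; exact: is_cvg_series_exp_coeff.
Qed.

Lemma entire_shift u : entire u -> entire (fun n => u n.+1).
Proof.
move=> [A [B [A0 B0 uAB]]]; exists (A * B), B; split => // [|n].
  exact: mulr_ge0.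
apply: le_trans (uAB n.+1) _.
rewrite exprS -!mulrA ler_wpM2l // ler_wpM2l // ler_wpM2l ?exprn_ge0 //.
by rewrite lef_pV2 ?posrE ?ltr0n ?fact_gt0 // ler_nat factS leq_pmull.
Qed.

Lemma entire_diffs u : entire u -> entire (pseries_diffs u).
Proof.
move=> [A [B [A0 B0 uAB]]]; exists (A * B), B; split => // [|n].
  exact: mulr_ge0.
rewrite /pseries_diffs normrM (ger0_norm (ler0n _ _)).
apply: le_trans (ler_wpM2l _ (uAB n.+1)) _ => //.
rewrite factS natrM exprS le_eqVlt; apply/orP; left; apply/eqP; field.
by rewrite nat1r !pnatr_eq0 -lt0n fact_gt0.
Qed.

Lemma psum_derive u x : entire u -> is_derive x 1 (psum u) (psum (pseries_diffs u) x).
Proof.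
move=> eu; apply: (@pseries_snd_diffs _ _ (`|x| + 1)).
- exact: entire_cvg.
- by apply: entire_cvg; exact: entire_diffs.
- by apply: entire_cvg; do 2 apply: entire_diffs.
- by rewrite [ltRHS]ger0_norm ?addr_ge0 // ltrDl.
Qed.

Lemma psumD u w x : entire u -> entire w ->
  psum (fun n => u n + w n) x = psum u x + psum w x.
Proof.
move=> eu ew; rewrite /psum -lim_seriesD; [|exact: entire_cvg..].
by congr (limn (series _)); apply/funext => n /=; rewrite mulrDl.
Qed.

Lemma psumZ u (a : R) x : entire u -> psum (fun n => a * u n) x = a * psum u x.
Proof.
move=> eu; rewrite /psum -[RHS]lim_seriesZ; last exact: entire_cvg.
by congr (limn (series _)); apply/funext => n /=; rewrite -mulrA.
Qed.

Lemma entireD u w : entire u -> entire w -> entire (fun n => u n + w n).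
Proof.
move=> [A [B [A0 B0 uAB]]] [A' [B' [A'0 B'0 wAB]]].
exists (A + A'), (B + B'); split => [||n]; rewrite ?addr_ge0 //.
apply: le_trans (ler_normD _ _) _; rewrite mulrDl lerD //.
  apply: le_trans (uAB n) _; rewrite ler_wpM2l // ler_wpM2r ?invr_ge0 //.
  by rewrite lerXn2r ?nnegrE ?addr_ge0 // lerDl.
apply: le_trans (wAB n) _; rewrite ler_wpM2l // ler_wpM2r ?invr_ge0 //.
by rewrite lerXn2r ?nnegrE ?addr_ge0 // lerDr.
Qed.

Lemma entireZ u (a : R) : entire u -> entire (fun n => a * u n).
Proof.
move=> [A [B [A0 B0 uAB]]]; exists (`|a| * A), B; split => // [|n].
  exact: mulr_ge0.
by rewrite normrM -mulrA ler_wpM2l.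
Qed.

Lemma psum_shift u x : entire u ->
  psum u x = u 0%N + x * psum (fun n => u n.+1) x.
Proof.
move=> eu; rewrite /psum -[X in _ + X]lim_seriesZ; last first.
  by apply: entire_cvg; exact: entire_shift.
have c1 : cvgn (series (x *: (fun n => u n.+1 * x ^+ n))).
  by apply: is_cvg_seriesZ; apply: entire_cvg; exact: entire_shift.
apply/cvg_lim => //; rewrite -cvg_shiftS.
have -> : (fun n => pseries u x n.+1) =
    (fun n => u 0%N + series (x *: (fun n => u n.+1 * x ^+ n)) n).
  apply/funext => n; rewrite /pseries/= /series/= big_nat_recl //= expr0 mulr1.
  congr (_ + _); apply: eq_bigr => i _.
  by rewrite /GRing.scale/= exprS mulrCA.
by apply: cvgD; [exact: cvg_cst | exact: c1].
Qed.

End EntireSeries.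

(** * The power series solution at the singular point 0 *)

Section Bessel.
Context {R : realType}.
Variable lambda : R[i].
Local Notation Re := complex.Re.
Local Notation Im := complex.Im.
Local Notation normc := ComplexField.Normc.normc.

(* Power series solution f of y'' + 3 / t y' + lambda y = 0 with f(0) = 1; below
   m = f' / t extends the singular term through t = 0. *)
Fixpoint bessel_coef n : R[i] :=
  match n with
  | 0%N => 1
  | 1%N => 0
  | m.+2 => - lambda * bessel_coef m * ((m.+2 * m.+4)%:R^-1)%:C
  end.

Lemma normc_real (x : R) : normc x%:C = `|x|.
Proof. by rewrite /= expr0n /= addr0 sqrtr_sqr. Qed.

Lemma normc_ge0 (z : R[i]) : 0 <= normc z.
Proof. by case: z => a b; exact: sqrtr_ge0. Qed.

Lemma normr_Re_le (z : R[i]) : `|Re z| <= normc z.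
Proof.
by case: z => a b /=; rewrite -sqrtr_sqr ler_sqrt ?addr_ge0 ?sqr_ge0 // lerDl sqr_ge0.
Qed.

Lemma normr_Im_le (z : R[i]) : `|Im z| <= normc z.
Proof.
by case: z => a b /=; rewrite -sqrtr_sqr ler_sqrt ?addr_ge0 ?sqr_ge0 // lerDr sqr_ge0.
Qed.

Lemma bessel_coef_bound n :
  normc (bessel_coef n) <= (1 + normc lambda) ^+ n / n`!%:R.
Proof.
set K := 1 + _; have K1 : 1 <= K by rewrite lerDl normc_ge0.
have K0 : 0 <= K by apply: le_trans K1.
(* The recursion steps by two, so the induction carries two consecutive indices. It uses |lambda| <=
   K <= K^2 and (n+2)! <= (n+2)(n+4) n!. *)
suff : normc (bessel_coef n) <= K ^+ n / n`!%:R /\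
       normc (bessel_coef n.+1) <= K ^+ n.+1 / n.+1`!%:R by case.
elim: n => [|n [IH0 IH1]]; split => //.
- by rewrite ComplexField.Normc.normc1 expr0 fact0 divr1.
- by rewrite ComplexField.Normc.normc0 divr_ge0 // exprn_ge0.
rewrite [bessel_coef _]/= !ComplexField.Normc.normcM normc_real.
rewrite normcN ger0_norm ?invr_ge0 //.
have K2 : normc lambda <= K ^+ 2.
  apply: (@le_trans _ _ K); first by rewrite lerDr.
  by rewrite expr2 -[leLHS]mulr1 ler_wpM2l.
rewrite exprS exprS mulrA -expr2 -mulrA.
apply: le_trans (ler_pM _ _ K2 (lexx _)) _; rewrite ?normc_ge0 //.
  by rewrite mulr_ge0 ?normc_ge0 ?invr_ge0.
rewrite -mulrA ler_wpM2l ?sqr_ge0 //.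
apply: le_trans (ler_wpM2r _ IH0) _; first by rewrite invr_ge0.
rewrite -mulrA ler_wpM2l ?exprn_ge0 // -invfM.
rewrite lef_pV2 ?posrE ?mulr_gt0 ?ltr0n ?fact_gt0 ?muln_gt0 //.
rewrite -natrM ler_nat !factS mulnA [leqRHS]mulnC leq_mul // leq_mul //.
by rewrite ltnS -addn3 leq_addr.
Qed.

Let u n := Re (bessel_coef n).
Let w n := Im (bessel_coef n).

Let entire_u : entire u.
Proof.
exists 1, (1 + normc lambda); split => [||n] //.
  by rewrite addr_ge0 ?normc_ge0.
by rewrite mul1r; apply: le_trans (normr_Re_le _) (bessel_coef_bound n).
Qed.

Let entire_w : entire w.
Proof.
exists 1, (1 + normc lambda); split => [||n] //.
  by rewrite addr_ge0 ?normc_ge0.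
by rewrite mul1r; apply: le_trans (normr_Im_le _) (bessel_coef_bound n).
Qed.

Let coef_rec n : (n.+2 * n.+4)%:R * u n.+2 + (Re lambda * u n + - Im lambda * w n) = 0
  /\ (n.+2 * n.+4)%:R * w n.+2 + (Re lambda * w n + Im lambda * u n) = 0.
Proof.
have K0 : (n.+2 * n.+4)%:R != 0 :> R by rewrite pnatr_eq0 muln_eq0.
have cE : bessel_coef n.+2 =
  - lambda * bessel_coef n * ((n.+2 * n.+4)%:R^-1)%:C by [].
have ReC (x : R) : Re x%:C = x by [].
have ImC (x : R) : Im x%:C = 0 by [].
rewrite /u /w cE !ReImE !(ReC, ImC).
move: (_%:R) K0 (Re (bessel_coef n)) (Im (bessel_coef n)) => K K0 p q.
move: (Re lambda) (Im lambda) => r i.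
by split; field.
Qed.

(** Comparison of coefficients: y'' and 3 y' / t contribute (n+2)(n+1) + 3(n+2) = (n+2)(n+4). The
    sequence [c'] is the other one of the real and imaginary parts, coupled through Im lambda. *)
Let psum_rec (c c' : R^nat) (a b : R) (t : R) : entire c -> entire c' ->
  (forall n, (n.+2 * n.+4)%:R * c n.+2 + (a * c n + b * c' n) = 0) ->
  psum (pseries_diffs (pseries_diffs c)) t +
  3 * psum (fun n => pseries_diffs c n.+1) t + (a * psum c t + b * psum c' t) = 0.
Proof.
move=> ec ec' rec; have ed := entire_diffs ec.
have es := entire_shift ed; have edd := entire_diffs ed.
have e1 := entireZ a ec; have e2 := entireZ b ec'; have e3 := entireZ 3 es.
transitivity (psum (fun n => pseries_diffs (pseries_diffs c) n +
    3 * pseries_diffs c n.+1 + (a * c n + b * c' n)) t).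
  rewrite (psumD _ (entireD edd e3) (entireD e1 e2)) (psumD _ edd e3).
  by rewrite (psumD _ e1 e2) !psumZ.
rewrite [X in psum X](_ : _ = (fun n => 0 * c n)); first by rewrite psumZ // mul0r.
apply/funext => n; rewrite mul0r -(rec n) /pseries_diffs natrM.
by ring.
Qed.

Let diffs_shift (c : R^nat) t : entire c -> c 1%N = 0 ->
  psum (pseries_diffs c) t = t * psum (fun n => pseries_diffs c n.+1) t.
Proof.
move=> ec c1; rewrite (psum_shift _ (entire_diffs ec)).
by rewrite [pseries_diffs c 0]mulr_natl mulr1n c1 add0r.
Qed.

Lemma bessel_entire_solution : exists y v a m : R -> R[i],
  [/\ y 0 = 1, forall t, v t = t%:C * m t,
    forall s t, derivative_from_C s y t (v t),
    forall s t, derivative_from_C s v t (a t) &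
    forall t, a t + 3 * m t + lambda * y t = 0].
Proof.
exists (fun t => psum u t +i* psum w t).
exists (fun t => psum (pseries_diffs u) t +i* psum (pseries_diffs w) t).
exists (fun t => psum (pseries_diffs (pseries_diffs u)) t +i*
                 psum (pseries_diffs (pseries_diffs w)) t).
exists (fun t => psum (fun n => pseries_diffs u n.+1) t +i*
                 psum (fun n => pseries_diffs w n.+1) t).
split.
- by rewrite (psum_shift _ entire_u) (psum_shift _ entire_w) !mul0r !addr0.
- move=> t; rewrite (diffs_shift t entire_u) // (diffs_shift t entire_w) //.
  by apply/eqP; rewrite eq_complex /= !mul0r subr0 addr0 !eqxx.
- by move=> s t; split; apply: is_derive_derivative_from; exact: psum_derive.
- move=> s t; split; apply: is_derive_derivative_from; apply: psum_derive;
  exact: entire_diffs.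
move=> t; apply/eqP; rewrite eq_complex; apply/andP; split; apply/eqP.
- rewrite !ReImE -[RHS](@psum_rec u w (Re lambda) (- Im lambda) t) //=.
    by ring.
  by move=> n; have [] := coef_rec n.
- rewrite !ReImE -[RHS](@psum_rec w u (Re lambda) (Im lambda) t) //=.
    by ring.
  by move=> n; have [] := coef_rec n.
Qed.

End Bessel.

(** * Nonvanishing and reduction of order *)

Section Existence.
Context {R : realType}.
Variable lambda : R[i].
Local Notation Re := complex.Re.
Local Notation Im := complex.Im.
Hypothesis Im_lambda : Im lambda != 0.

Let Re_muln (x : R) (z : R[i]) : Re (x%:C * z) = x * Re z.
Proof. by case: z => a b; rewrite /= mul0r subr0. Qed.
Let Im_muln (x : R) (z : R[i]) : Im (x%:C * z) = x * Im z.
Proof. by case: z => a b; rewrite /= mul0r addr0. Qed.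

(* At a zero t1 of y the monotone function Q = - Im lambda t^3 Im (conj y y')
   vanishes, as it does at 0, so Q' = (Im lambda)^2 t^3 |y|^2 is zero on [0, t1],
   although y 0 = 1. *)
Lemma bessel_neq0 (y v a m : R -> R[i]) :
  y 0 = 1 -> (forall t, v t = t%:C * m t) ->
  (forall t, derivative_from_C 0 y t (v t)) ->
  (forall t, derivative_from_C 0 v t (a t)) ->
  (forall t, a t + 3 * m t + lambda * y t = 0) ->
  forall t, 0 <= t -> y t != 0.
Proof.
move=> y0 vE dy dv aE t1 t1_ge0; apply/negP => /eqP yt1.
(* The cube is written as a product because Q is also differentiated at 0, where the rule for
   [u ^+ 3] does not apply. *)
pose Q u := - Im lambda * (u * u * u * (Re (y u) * Im (v u) - Im (y u) * Re (v u))).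
pose dQ t := Im lambda ^+ 2 * (t * t * t) * (Re (y t) * Re (y t) + Im (y t) * Im (y t)).
have dQE t : 0 <= t -> derivative_from 0 Q t (dQ t).
  move=> _; have [yR yI] := dy t; have [vR vI] := dv t.
  have vRE : Re (v t) = t * Re (m t) by rewrite vE Re_muln.
  have vIE : Im (v t) = t * Im (m t) by rewrite vE Im_muln.
  have /eqP := aE t; rewrite -addrA addr_eq0 => /eqP at_.
  have three : (3 : R[i]) = (3%:R : R)%:C by rewrite rmorph_nat.
  have aRE : Re (a t) = - (3 * Re (m t) + (Re lambda * Re (y t) - Im lambda * Im (y t))).
    by rewrite at_ three complex_ReN complex_ReD Re_muln complex_ReM.
  have aIE : Im (a t) = - (3 * Im (m t) + (Re lambda * Im (y t) + Im lambda * Re (y t))).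
    by rewrite at_ three complex_ImN complex_ImD Im_muln complex_ImM.
  rewrite /Q; apply: derivative_from_eq; first by derivative_from_rules.
  by rewrite /dQ vRE vIE aRE aIE; ring.
have dQ_ge0 t : 0 <= t -> 0 <= dQ t.
  move=> t0; rewrite /dQ; apply: mulr_ge0.
    by rewrite mulr_ge0 ?sqr_ge0 // !mulr_ge0.
  by rewrite addr_ge0 // -expr2 sqr_ge0.
have Q0 : Q 0 = 0 by rewrite /Q !mul0r mulr0.
have Qt1 : Q t1 = 0 by rewrite /Q yt1 /= !mul0r subrr !mulr0.
have Q_le0 t : 0 <= t -> t <= t1 -> Q t <= 0.
  by move=> t0 tt1; rewrite -Qt1; exact: (derivative_from_ndecr dQE dQ_ge0).
have t1_gt0 : 0 < t1.
  rewrite lt_neqAle t1_ge0 andbT; apply/eqP => t10.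
  by move: yt1; rewrite -t10 y0 => /eqP; rewrite oner_eq0.
have [d d0 dP] : exists2 d, 0 < d & forall t, 0 < t -> t < d -> 0 < Re (y t).
  have [/derivative_from_within_continuous] := dy 0.
  rewrite y0 => /cvgrPdist_lt /(_ 1 ltr01).
  rewrite near_withinE => -[d /= d0 dP] _; exists d => // t t0 td.
  have := dP t; rewrite /ball_/= sub0r normrN gtr0_norm // => /(_ td (ltW t0)).
  by rewrite ltr_norml => /andP[_]; rewrite ltrBlDr ltrDl.
(* Below d the real part of y is positive, so Q' > 0 at the mean value point; s <= t1 gives Q s <= 0
   = Q 0, a contradiction. *)
pose s := Num.min d t1.
have s0 : 0 < s by rewrite lt_min d0.
have [c] := derivative_from_MVT dQE (lexx 0) s0.
rewrite in_itv /= subr0 Q0 subr0 => /andP[c0 cs] E.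
have : 0 < dQ c * s.
  apply: mulr_gt0 => //; apply: mulr_gt0.
    by apply: mulr_gt0; [rewrite exprn_even_gt0 | rewrite !mulr_gt0].
  have h := dP c c0; rewrite ltr_wpDr // -?expr2 ?sqr_ge0 // exprn_gt0 //.
  by apply: h; apply: lt_le_trans cs _; rewrite ge_min lexx.
by rewrite -E ltNge Q_le0 // ?(ltW s0) // ge_min lexx orbT.
Qed.

(* Reduction of order: the second solution is f I with I' = 1 / (t^3 f^2). *)
Lemma modal_solution_exists (t0 : R) (y0 y1 : R[i]) : 0 < t0 ->
  exists y, modal_solution lambda t0 y0 y1 y.
Proof.
move=> t0_gt0.
have [f [vf [af [m [f0 vfE df dvf afE]]]]] := bessel_entire_solution lambda.
have f_neq0 : forall t, 0 <= t -> f t != 0 := bessel_neq0 f0 vfE (df 0) (dvf 0) afE.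
pose T (t : R) : R[i] := (t ^+ 3)%:C.
have T_neq0 t : 0 < t -> T t != 0.
  by move=> tp; rewrite /T fmorph_eq0 expf_neq0 // gt_eqF.
have dT t : 0 < t -> derivative_from_C 0 T t ((3 / t)%:C * T t).
  move=> tp; rewrite -rmorphM; apply: derivative_from_C_real.
  by apply: derivative_from_cube; rewrite gt_eqF.
pose J t := (T t * (f t * f t))^-1.
have dJ t : 0 < t -> exists l, derivative_from_C 0 J t l.
  move=> tp.
  have h := derivative_from_CM (dT t tp) (derivative_from_CM (df 0 t) (df 0 t)).
  eexists; apply: (derivative_from_CV tp _ h).
  by rewrite !mulf_neq0 ?T_neq0 ?f_neq0 // ltW.
(* Integrating from t0 / 2 makes t0 interior, so I is differentiable there. *)
have t2 : 0 < t0 / 2 by rewrite divr_gt0.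
have t20 : t0 / 2 < t0 by rewrite ltr_pdivrMr // ltr_pMr // ltr1n.
have Jcont (g : R -> R) : (forall t, 0 < t -> exists l, derivative_from 0 g t l) ->
    forall t, t0 / 2 <= t -> {for t, continuous g}.
  move=> dg t tt; have tp : 0 < t by exact: lt_le_trans tt.
  have [l /(derivative_from_is_derive tp) [dgt _]] := dg t tp.
  by apply: differentiable_continuous; apply/derivable1_diffP.
have [I1 dI1] := continuous_antiderivative (Jcont (fun t => Re (J t))
  (fun t tp => let: ex_intro l h := dJ t tp in ex_intro _ _ h.1)).
have [I2 dI2] := continuous_antiderivative (Jcont (fun t => Im (J t))
  (fun t tp => let: ex_intro l h := dJ t tp in ex_intro _ _ h.2)).
pose I t : R[i] := I1 t +i* I2 t.
have dI t : t0 <= t -> derivative_from_C t0 I t (J t).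
  move=> tt; have t2t : t0 / 2 < t by exact: lt_le_trans tt.
  by split; apply: is_derive_derivative_from; [exact: dI1 | exact: dI2].
(* K = f J = f I', hence (f I)' = f' I + K. *)
pose K t := (T t * f t)^-1.
have dK t : t0 <= t -> derivative_from_C t0 K t
    (- ((3 / t)%:C * T t * f t + T t * vf t) / (T t * f t) ^+ 2).
  move=> tt; have tp : 0 < t by exact: lt_le_trans tt.
  apply: (derivative_from_C_widen (ltW t0_gt0)).
  apply: (derivative_from_CV tp); first by rewrite mulf_neq0 ?T_neq0 ?f_neq0 // ltW.
  exact: derivative_from_CM (dT t tp) (df 0 t).
pose g t := f t * I t.
pose vg t := vf t * I t + K t.
pose ag t := af t * I t + vf t * J t -
  ((3 / t)%:C * T t * f t + T t * vf t) / (T t * f t) ^+ 2.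
(* Cramer's rule for the initial data: the Wronskian f g' - f' g = f K equals 1 / t^3. *)
pose A := T t0 * (y0 * vg t0 - y1 * g t0).
pose B := T t0 * (f t0 * y1 - vf t0 * y0).
have T0 := T_neq0 _ t0_gt0.
have f0n := f_neq0 _ (ltW t0_gt0).
exists (fun t => A * f t + B * g t), (fun t => A * vf t + B * vg t),
  (fun t => A * af t + B * ag t); split.
- rewrite /A /B /g /vg /K; move: (T t0) T0 (f t0) f0n => S Sn z zn.
  by field; rewrite ?Sn ?zn.
- rewrite /A /B /g /vg /K; move: (T t0) T0 (f t0) f0n => S Sn z zn.
  by field; rewrite ?Sn ?zn.
move=> t tt; have tp : 0 < t by exact: lt_le_trans tt.
have Tn := T_neq0 t tp; have fn := f_neq0 t (ltW tp).
have dg : derivative_from_C t0 g t (vg t).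
  apply: derivative_from_C_eq (derivative_from_CM (df t0 t) (dI t tt)) _.
  rewrite /vg /J /K; move: (T t) Tn (f t) fn => S Sn z zn.
  by field; rewrite ?Sn ?zn.
have dvg : derivative_from_C t0 vg t (ag t).
  apply: derivative_from_C_eq (derivative_from_CD
    (derivative_from_CM (dvf t0 t) (dI t tt)) (dK t tt)) _.
  by rewrite /ag mulNr.
have lin (c h : R -> R[i]) lc lh : derivative_from_C t0 c t lc ->
    derivative_from_C t0 h t lh ->
    derivative_from_C t0 (fun u => A * c u + B * h u) t (A * lc + B * lh).
  move=> dc dh; apply: derivative_from_C_eq (derivative_from_CD
    (derivative_from_CM (derivative_from_C_cst t0 A t) dc)
    (derivative_from_CM (derivative_from_C_cst t0 B t) dh)) _.
  by rewrite !mul0r !add0r.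
split; [exact: lin | exact: lin |].
have odef : af t + (3 / t)%:C * vf t + lambda * f t = 0.
  rewrite -(afE t) vfE mulrA -rmorphM divfK ?gt_eqF //.
  by rewrite rmorph_nat.
have odeg : ag t + (3 / t)%:C * vg t + lambda * g t = 0.
  rewrite [LHS](_ : _ = I t * (af t + (3 / t)%:C * vf t + lambda * f t)).
    by rewrite odef mulr0.
  rewrite /ag /vg /g /J /K; move: (_%:C) (T t) Tn (f t) fn => c S Sn z zn.
  by field; rewrite ?Sn ?zn.
rewrite [LHS](_ : _ = A * (af t + (3 / t)%:C * vf t + lambda * f t) +
  B * (ag t + (3 / t)%:C * vg t + lambda * g t)); last by ring.
by rewrite odef odeg !mulr0 addr0.
Qed.

End Existence.

(** * Spectral reduction *)

Section Spectral.
Context {R : realType} {N : nat}.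
Variable G : 'M[R]_N.
Hypothesis hG : G *m G^T = G^T *m G.
Local Notation Re := complex.Re.
Local Notation Im := complex.Im.
Local Notation toC := (map_mx (real_complex R)).

(** In this form the rows of P are left eigenvectors and the columns of its inverse right
    eigenvectors. Existence is the spectral theorem for the complexified matrix. *)
Lemma normal_diagonalization : exists (P : 'M[R[i]]_N) (d : 'rV[R[i]]_N),
  [/\ P \in unitmx, invmx P = (map_mx conjc P)^T & P *m toC G = diag_mx d *m P].
Proof.
pose A := toC G.
have Anormal : A \is normalmx.
  apply/normalmxP.
  have -> : (map_mx Num.conj A^T)%sesqui = toC G^T.
    by apply/matrixP => i k; rewrite !mxE; exact: conjc_real.
  by rewrite /A -!map_mxM hG.
have /orthomx_spectralP AE := Anormal.
have Pu := spectral_unit A.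
exists (spectralmx A), (spectral_diag A); split => //.
  rewrite (invmx_unitary (spectral_unitarymx A)).
  by apply/matrixP => i k; rewrite !mxE.
by rewrite -/A {2}AE -!mulmxA mulKVmx.
Qed.

Variable lambda : 'I_N -> R[i].
Hypothesis hlambda : char_poly (toC G) = \prod_(i < N) ('X - (lambda i)%:P).

Variables (P : 'M[R[i]]_N) (d : 'rV[R[i]]_N).
Hypotheses (Pu : P \in unitmx) (PG : P *m toC G = diag_mx d *m P).

Let rootE x : root (char_poly (toC G)) x = [exists i, x == lambda i].
Proof.
rewrite hlambda poly.rootE horner_prod.
apply/prodf_eq0/existsP => [[i _ h]|[i h]]; exists i => //.
  by rewrite -subr_eq0; rewrite hornerXsubC in h.
by rewrite hornerXsubC subr_eq0.
Qed.

Lemma diag_eigenvalue i : exists k, d 0 i = lambda k.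
Proof.
have : eigenvalue (toC G) (d 0 i).
  apply/eigenvalueP; exists (row i P).
    by rewrite -row_mul PG; apply/rowP => k; rewrite !mxE (bigD1 i) //= !mxE eqxx
      big1 ?addr0 // => l li; rewrite !mxE eq_sym (negPf li) mul0r.
  apply/negP => /eqP h; have : row i (P *m invmx P) = 0 by rewrite row_mul h mul0mx.
  rewrite mulmxV // row1 => /rowP/(_ i); rewrite !mxE !eqxx => /eqP.
  by rewrite oner_eq0.
by rewrite eigenvalue_root_char rootE => /existsP[k /eqP ->]; exists k.
Qed.

(** An eigenvector for lambda k, written in the basis of rows of P, has a nonzero coordinate i,
    which forces d i = lambda k. *)
Lemma eigenvalue_diag k : exists i, d 0 i = lambda k.
Proof.
have : eigenvalue (toC G) (lambda k).
  by rewrite eigenvalue_root_char rootE; apply/existsP; exists k.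
move=> /eigenvalueP[v vG v0].
pose z := v *m invmx P.
have zd : z *m diag_mx d = lambda k *: z.
  have -> : diag_mx d = P *m toC G *m invmx P by rewrite PG mulmxK.
  by rewrite /z !mulmxA mulmxKV // vG scalemxAl.
have /rV0Pn[i zi] : z != 0.
  apply/negP => /eqP z0; move: v0; rewrite -(mulmxKV Pu v) -/z z0.
  by rewrite mul0mx eqxx.
exists i; apply: (mulfI zi); move/rowP/(_ i): zd.
by rewrite mul_mx_diag !mxE => ->; rewrite mulrC.
Qed.

(** With z = P x, unitarity gives |x|^2 = sum |z_i|^2 and x^T G x = sum d_i |z_i|^2; real parts are
    compared termwise. *)
Lemma quadratic_form_ge (m : R) (x : 'cV[R]_N) :
  invmx P = (map_mx conjc P)^T ->
  (forall i, m <= Re (lambda i)) ->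
  m * (\sum_i x i 0 ^+ 2) <= \sum_i x i 0 * (G *m x) i 0.
Proof.
move=> PV mle.
have [z zE] : {z | z = P *m toC x} by exists (P *m toC x).
have xz : (toC x)^T *m invmx P = (map_mx conjc z)^T.
  rewrite PV zE; apply/rowP => i; rewrite !mxE rmorph_sum; apply: eq_bigr => k _.
  by rewrite !mxE rmorphM mulrC; congr (_ * _); exact/esym/conjc_real.
have zz i : conjc (z i 0) * z i 0 = (Re (z i 0) ^+ 2 + Im (z i 0) ^+ 2)%:C.
  by rewrite add_Re2_Im2 mulrC -normCK.
have GE : toC G = invmx P *m diag_mx d *m P by rewrite -mulmxA -PG mulKmx.
have form : (\sum_i x i 0 * (G *m x) i 0)%:C =
    \sum_i d 0 i * (Re (z i 0) ^+ 2 + Im (z i 0) ^+ 2)%:C.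
  have -> : (\sum_i x i 0 * (G *m x) i 0)%:C = ((toC x)^T *m toC (G *m x)) 0 0.
    by rewrite mxE rmorph_sum; apply: eq_bigr => i _; rewrite !mxE rmorphM.
  rewrite map_mxM GE !mulmxA xz -mulmxA -zE mxE; apply: eq_bigr => i _.
  by rewrite mul_mx_diag !mxE -zz mulrAC mulrA [LHS]mulrC mulrA.
have nrm : (\sum_i x i 0 ^+ 2)%:C =
    \sum_i (Re (z i 0) ^+ 2 + Im (z i 0) ^+ 2)%:C.
  have -> : (\sum_i x i 0 ^+ 2)%:C = ((toC x)^T *m toC x) 0 0.
    by rewrite mxE rmorph_sum; apply: eq_bigr => i _; rewrite !mxE -rmorphM expr2.
  have xE : toC x = invmx P *m z by rewrite zE mulKmx.
  rewrite [X in (_ *m X) 0 0]xE mulmxA xz mxE; apply: eq_bigr => i _.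
  by rewrite !mxE zz.
have {}form := congr1 (@complex.Re R) form.
have {}nrm := congr1 (@complex.Re R) nrm.
have ReC (t : R) : Re t%:C = t by [].
have Resum (f : 'I_N -> R[i]) : Re (\sum_i f i) = \sum_i Re (f i).
  by apply: (big_morph (@complex.Re R)) => // a b; exact: complex_ReD.
rewrite ReC Resum in form; rewrite ReC Resum in nrm.
rewrite form nrm mulr_sumr; apply: ler_sum => i _.
rewrite complex_ReM !ReC [Im _%:C]/= mulr0 subr0.
rewrite ler_wpM2r ?addr_ge0 ?sqr_ge0 //.
by have [k ->] := diag_eigenvalue i.
Qed.

End Spectral.

(** * First-order decay and passage between system and modal solutions *)

Section Systems.
Context {R : realType} {N : nat}.
Local Notation Re := complex.Re.
Local Notation Im := complex.Im.
Local Notation normc := ComplexField.Normc.normc.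
Local Notation toC := (map_mx (real_complex R)).

Lemma derivative_from_sum s (f : 'I_N -> R -> R) t (l : 'I_N -> R) :
  (forall i, derivative_from s (f i) t (l i)) ->
  derivative_from s (fun u => \sum_i f i u) t (\sum_i l i).
Proof.
move=> df; elim: (index_enum _) => [|i r IH].
  rewrite big_nil; apply: derivative_from_ext (derivative_from_cst _ 0 _) => u.
  by rewrite big_nil.
rewrite big_cons; apply: derivative_from_ext (derivative_fromD (df i) IH) => u.
by rewrite big_cons.
Qed.

Lemma derivative_from_C_sum s (f : 'I_N -> R -> R[i]) t (l : 'I_N -> R[i]) :
  (forall i, derivative_from_C s (f i) t (l i)) ->
  derivative_from_C s (fun u => \sum_i f i u) t (\sum_i l i).
Proof.
have ReS (h : 'I_N -> R[i]) : Re (\sum_i h i) = \sum_i Re (h i).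
  by apply: (big_morph (@complex.Re R)) => // a b; exact: complex_ReD.
have ImS (h : 'I_N -> R[i]) : Im (\sum_i h i) = \sum_i Im (h i).
  by apply: (big_morph (@complex.Im R)) => // a b; exact: complex_ImD.
move=> df; split.
  rewrite ReS; apply: derivative_from_ext (derivative_from_sum (fun i => (df i).1)).
  by move=> u; rewrite ReS.
rewrite ImS; apply: derivative_from_ext (derivative_from_sum (fun i => (df i).2)).
by move=> u; rewrite ImS.
Qed.

Lemma exponentially_stable_of_form (G : 'M[R]_N) (m : R) :
  (forall x : 'cV[R]_N, m * (\sum_i x i 0 ^+ 2) <= \sum_i x i 0 * (G *m x) i 0) ->
  exponentially_stable G m.
Proof.
move=> Gm; exists 1 => r x xsol s t rs st; rewrite mul1r.
pose S u := \sum_i x u i 0 * x u i 0.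
have SE u : S u = \sum_i x u i 0 ^+ 2 by [].
pose dS u := \sum_i (- (G *m x u) i 0 * x u i 0 + x u i 0 * - (G *m x u) i 0).
(* |x|^2 e^(2 m u) is nonincreasing by the bound on the quadratic form, so C = 1 works. *)
pose g u := S u * expR (2 * m * u).
have g_ninc : g t <= g s.
  rewrite -lerN2; apply: (@derivative_from_ndecr _ r (fun u => - g u)
    (fun u => (- dS u - 2 * m * S u) * expR (2 * m * u))) => // u ru.
    have dSu : derivative_from r S u (dS u).
      apply: derivative_from_sum => i; have := xsol u ru i; rewrite mxE => dx.
      by apply: derivative_fromM; exact: dx.
    apply: derivative_from_eq (derivative_fromN
      (derivative_fromM dSu (@derivative_from_expR _ _ _ _))) _.
    by ring.
  rewrite mulr_ge0 ?expR_ge0 //.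
  have -> : dS u = - (2 * \sum_i x u i 0 * (G *m x u) i 0).
    rewrite mulr_sumr -sumrN; apply: eq_bigr => i _; ring.
  by rewrite opprK -mulrA -mulrBr mulr_ge0 // subr_ge0 SE Gm.
rewrite /norm2 -[expR _]ger0_norm ?expR_ge0 // -sqrtr_sqr -sqrtrM ?sqr_ge0 //.
apply: ler_wsqrtr; rewrite -!SE -expRM_natl.
have -> : 2%:R * (- m * (t - s)) = 2 * m * s - 2 * m * t :> R by ring.
rewrite expRD mulrAC expRN ler_pdivlMr ?expR_gt0 //.
by rewrite [leRHS]mulrC.
Qed.

Lemma normr_le_norm2 (x : 'cV[R]_N) i : `|x i 0| <= norm2 x.
Proof.
rewrite -sqrtr_sqr /norm2 ler_sqrt ?sumr_ge0 // => [|k _]; last exact: sqr_ge0.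
by rewrite (bigD1 i) //= lerDl sumr_ge0 // => k _; exact: sqr_ge0.
Qed.

Lemma norm2Z n (c : R) (x : 'cV[R]_n) : norm2 (c *: x) = `|c| * norm2 x.
Proof.
rewrite /norm2 -sqrtr_sqr -sqrtrM ?sqr_ge0 // mulr_sumr.
by congr Num.sqrt; apply: eq_bigr => i _; rewrite mxE exprMn.
Qed.

Lemma norm2_ge0 n (x : 'cV[R]_n) : 0 <= norm2 x.
Proof. exact: sqrtr_ge0. Qed.

Lemma normc_functional_le (v : 'rV[R[i]]_N) : exists2 M, 0 < M &
  forall x : 'cV[R]_N, normc ((v *m toC x) 0 0) <= M * norm2 x.
Proof.
(* The summand 1 makes the constant positive, hence invertible. *)
exists (1 + \sum_i normc (v 0 i)).
  by rewrite ltr_pwDl // sumr_ge0 // => i _; exact: normc_ge0.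
move=> x; apply: (@le_trans _ _ (\sum_i normc (v 0 i) * norm2 x)).
  rewrite mxE; apply: (big_rec2 (fun a b => normc a <= b)).
    by rewrite ComplexField.Normc.normc0.
  move=> i a b _ ab; apply: le_trans (le_normcD _ _) _; apply: lerD => //.
  rewrite ComplexField.Normc.normcM mxE normc_real.
  by rewrite ler_wpM2l ?normc_ge0 ?normr_le_norm2.
by rewrite -mulr_suml ler_wpM2r ?norm2_ge0 // lerDr.
Qed.

Definition real_part (u : 'cV[R[i]]_N) : 'cV[R]_N := \col_k Re (u k 0).

Section Eigenvectors.
Variables (G : 'M[R]_N) (t0 : R) (l : R[i]) (v : 'rV[R[i]]_N) (u : 'cV[R[i]]_N).
Hypotheses (vG : v *m toC G = l *: v) (Gu : toC G *m u = l *: u).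
Hypotheses (vu : v *m u = 1%:M) (l_nonreal : Im l != 0).

Lemma modal_of_solution x0 v0 x : second_order_solution G t0 x0 v0 x ->
  modal_solution l t0 ((v *m toC x0) 0 0) ((v *m toC v0) 0 0)
    (fun t => (v *m toC (x t)) 0 0).
Proof.
move=> [w [a [x0E v0E xP]]].
exists (fun t => (v *m toC (w t)) 0 0), (fun t => (v *m toC (a t)) 0 0).
split; rewrite ?x0E ?v0E // => t tt; have [dx dw E] := xP t tt.
have lin (f : R -> 'cV[R]_N) df : derivative_from_cV t0 f t df ->
    derivative_from_C t0 (fun s => (v *m toC (f s)) 0 0) t ((v *m toC df) 0 0).
  move=> dfP; apply: (@derivative_from_C_eq _ _ _ _ (\sum_k v 0 k * (df k 0)%:C)).
    rewrite (_ : (fun s => _) = (fun s => \sum_k v 0 k * (f s k 0)%:C)); last first.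
      by apply/funext => s; rewrite mxE; apply: eq_bigr => k _; rewrite mxE.
    apply: derivative_from_C_sum => k; apply: derivative_from_C_eq
      (derivative_from_CM (derivative_from_C_cst _ _ _)
        (derivative_from_C_real (dfP k))) _.
    by rewrite mul0r add0r.
  by rewrite mxE; apply: eq_bigr => k _; rewrite mxE.
split; [exact: lin | exact: lin |].
have -> : (v *m toC (a t)) 0 0 + (3 / t)%:C * (v *m toC (w t)) 0 0 +
    l * (v *m toC (x t)) 0 0 =
    (v *m toC (a t + (3 / t) *: w t + G *m x t)) 0 0.
  rewrite !map_mxD map_mxM map_mxZ !mulmxDr mulmxA vG -scalemxAl -scalemxAr.
  by rewrite !mxE.
by rewrite E map_mx0 mulmx0 mxE.
Qed.

(** G is real and so commutes with taking real parts of the complex solution y u. *)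
Lemma solution_of_modal y0 y1 y : modal_solution l t0 y0 y1 y ->
  second_order_solution G t0 (real_part (y0 *: u)) (real_part (y1 *: u))
    (fun t => real_part (y t *: u)).
Proof.
move=> [w [a [y0E y1E yP]]].
exists (fun t => real_part (w t *: u)), (fun t => real_part (a t *: u)).
split; rewrite ?y0E ?y1E // => t tt; have [dy dw E] := yP t tt.
have lin (f : R -> R[i]) df : derivative_from_C t0 f t df ->
    derivative_from_cV t0 (fun s => real_part (f s *: u)) t (real_part (df *: u)).
  move=> dfP k; have [+ _] := derivative_from_CM dfP (derivative_from_C_cst t0 (u k 0) t).
  rewrite mulr0 addr0 !mxE; apply: derivative_from_ext => s.
  by rewrite !mxE.
split; [exact: lin | exact: lin |].
have ReC c (z : R[i]) : c * Re z = Re (c%:C * z).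
  by rewrite complex_ReM /= mul0r subr0.
have GR z : G *m real_part (z *: u) = real_part ((l * z) *: u).
  apply/colP => k; rewrite !mxE.
  have /colP/(_ k) := Gu; rewrite !mxE => Guk.
  rewrite [l * z]mulrC -mulrA -Guk mulr_sumr.
  rewrite (big_morph (@complex.Re R) (@complex_ReD R) (erefl _)).
  by apply: eq_bigr => i _; rewrite !mxE ReC mulrCA.
rewrite GR; apply/colP => k; rewrite !mxE.
rewrite ReC mulrA -!complex_ReD -!mulrDl E mul0r //.
Qed.

(** Re (z u) is half of z u plus its conjugate. As conj u is an eigenvector for conj l, which
    differs from l, the functional v kills it. *)
Lemma functional_real_part z : (v *m toC (real_part (z *: u))) 0 0 = z / 2.
Proof.
pose uc := map_mx conjc u.
have Guc : toC G *m uc = conjc l *: uc.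
  rewrite -map_mxZ -Gu map_mxM; congr (_ *m _).
  by apply/matrixP => i k; rewrite !mxE; exact/esym/conjc_real.
have vuc : v *m uc = 0.
  have h : l *: (v *m uc) = conjc l *: (v *m uc).
    by rewrite scalemxAl -vG -mulmxA Guc scalemxAr.
  have /eqP : (l - conjc l) *: (v *m uc) = 0 by rewrite scalerBl h subrr.
  rewrite scaler_eq0 => /orP[|/eqP //].
  rewrite subcJ !mulf_eq0 pnatr_eq0 /= => /orP[|].
    by rewrite fmorph_eq0 (negPf l_nonreal).
  by rewrite eq_complex /= eqxx oner_eq0.
have -> : toC (real_part (z *: u)) = 2^-1 *: (z *: u + conjc z *: uc).
  apply/colP => k; rewrite !mxE.
  by rewrite ReJ_add rmorphM [RHS]mulrC.
rewrite -scalemxAr mulmxDr -!scalemxAr vuc vu scaler0 addr0 !mxE eqxx mulr1.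
by rewrite mulrC.
Qed.

End Eigenvectors.
End Systems.

(** * Instability and the value of the growth rate *)

Section Final.
Context {R : realType}.
Local Notation Re := complex.Re.
Local Notation Im := complex.Im.
Local Notation normc := ComplexField.Normc.normc.
Local Notation toC := (map_mx (real_complex R)).
Local Notation data := (R[i]^o * R[i]^o)%type.

Lemma line_proper (L : {vspace data}) : \dim L = 1%N -> exists d, d \notin L.
Proof.
move=> L1; apply: contrapT => all_in.
have : ({:data} <= L)%VS.
  by apply/subvP => d _; apply: contrapT => /negP dL; apply: all_in; exists d.
by move/dimvS; rewrite L1 dimvf.
Qed.

Lemma unstable_of_modal_growth N (G : 'M[R]_N) (t0 : R) (l : R[i])
    (v : 'rV[R[i]]_N) (u : 'cV[R[i]]_N) (rho : R) :
  v *m toC G = l *: v -> toC G *m u = l *: u -> v *m u = 1%:M -> Im l != 0 ->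
  0 < rho -> generic_modal_growth l t0 rho -> exponentially_unstable G t0.
Proof.
move=> vG Gu vu l_nonreal rho0 [L L1 LP] eps eps0.
have [[y0 y1] yL] := line_proper L1.
pose n := norm2 (col_mx (real_part (y0 *: u)) (real_part (y1 *: u))).
(* Scaling the data by s brings their norm to eps n / (1 + n) < eps. *)
pose s := eps / (1 + n).
have n1 : 0 < 1 + n by rewrite ltr_pwDl // norm2_ge0.
have s0 : 0 < s by rewrite divr_gt0.
have sC : s%:C != 0 by rewrite fmorph_eq0 gt_eqF.
have scale_notin (c : R[i]) : c != 0 -> (c * y0, c * y1) \notin L.
  move=> c0; apply: contra yL => h.
  have -> : (y0, y1) = c^-1 *: ((c * y0, c * y1) : data).
    by congr (_, _); rewrite /GRing.scale/= mulKf.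
  exact: memvZ.
exists (real_part ((s%:C * y0) *: u)), (real_part ((s%:C * y1) *: u)).
split.
- have -> : col_mx (real_part ((s%:C * y0) *: u)) (real_part ((s%:C * y1) *: u)) =
      s *: col_mx (real_part (y0 *: u)) (real_part (y1 *: u)).
    have sE z : real_part ((s%:C * z) *: u) = s *: real_part (z *: u).
      by apply/colP => k; rewrite !mxE -mulrA complex_ReM /= mul0r subr0.
    by rewrite !sE scale_col_mx.
  rewrite norm2Z gtr0_norm // -/n /s mulrAC ltr_pdivrMr // ltr_pM2l //.
  by rewrite ltrDr.
- have [[y yP] _] := LP _ _ (scale_notin _ sC).
  by exists (fun t => real_part (y t *: u)); exact: (solution_of_modal Gu).
have [M M0 MP] := normc_functional_le v.
(* The limit rho of the logarithmic rate yields exponent rho / 2 eventually; M converts the modal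
   bound into one on |x|. *)
exists M^-1, (rho / 2); split; rewrite ?invr_gt0 ?divr_gt0 // => x xP.
have := modal_of_solution vG xP.
rewrite !(functional_real_part vG Gu vu l_nonreal) ![s%:C * _ / 2]mulrAC.
have h0 : s%:C / 2 != 0 by rewrite mulf_neq0 // invr_eq0 pnatr_eq0.
move/(proj2 (LP _ _ (scale_notin _ h0))) => [Yoo Yrho].
have r2 : 0 < rho / 2 by rewrite divr_gt0.
move/cvgryPge : Yoo => /(_ 1) Y1.
move/cvgrPdist_le : Yrho => /(_ _ r2) Yr.
near=> t.
have tp : 0 < t by near: t; apply: nbhs_pinfty_gt; rewrite num_real.
have y1t : 1 <= normc ((v *m toC (x t)) 0 0) by near: t.
have : `|rho - t^-1 * ln (normc ((v *m toC (x t)) 0 0))| <= rho / 2 by near: t.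
have yp : 0 < normc ((v *m toC (x t)) 0 0) by exact: lt_le_trans y1t.
rewrite ler_norml => /andP[_ h].
rewrite [leLHS]mulrC ler_pdivrMr // [leRHS]mulrC; apply: le_trans (MP (x t)).
rewrite -(lnK yp) ler_expR.
have {}h : rho / 2 <= t^-1 * ln (normc ((v *m toC (x t)) 0 0)).
  move: h; move: (_ * ln _) => q; lra.
by rewrite ler_pdivlMl // mulrC in h.
Unshelve. all: by end_near. Qed.

Lemma square_root_growth_rate (mu : R[i]) (a b : R) :
  mu ^+ 2 = a +i* b -> b != 0 ->
  [/\ Im mu != 0, `|Im mu| = Num.sqrt ((Num.sqrt (a ^+ 2 + b ^+ 2) - a) / 2) &
      exists2 k : R[i], k ^+ 2 = - (a +i* b) & Re k = `|Im mu|].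
Proof.
case: mu => p q; rewrite expr2 => -[aE bE] b0; rewrite [Im _]/=.
have q0 : q != 0 by apply: contra b0 => /eqP q0; rewrite -bE q0 mulr0 mul0r addr0.
split => //.
  have -> : a ^+ 2 + b ^+ 2 = (p ^+ 2 + q ^+ 2) ^+ 2 by rewrite -aE -bE; ring.
  rewrite sqrtr_sqr [`|_ + _|]ger0_norm ?addr_ge0 ?sqr_ge0 // -aE.
  have -> : (p ^+ 2 + q ^+ 2 - (p * p - q * q)) / 2 = q ^+ 2 by field.
  by rewrite sqrtr_sqr.
(* k is -i mu or i mu, with the sign chosen so that Re k = |q|. *)
exists (if 0 <= q then q -i* p else (- q) +i* p).
  case: ifP => _; apply/eqP; rewrite eq_complex -aE -bE expr2 /=;
  by apply/andP; split; apply/eqP; ring.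
by case: (leP 0 q) => q_ge0 /=; [rewrite ger0_norm | rewrite ltr0_norm].
Qed.

End Final.

Theorem corollary3 (R : realType) (N : nat) (hN : (0 < N)%N) (t0 : R) (ht0 : 0 < t0)
  (G : 'M[R]_N) (hG : G *m G^T = G^T *m G)
  (lambda : 'I_N -> R[i])
  (hlambda : char_poly (map_mx (real_complex R) G)
             = \prod_(i < N) ('X - (lambda i)%:P))
  (hpos : forall i, 0 < complex.Re (lambda i))
  (j : 'I_N) (a b : R) (hj : lambda j = a +i* b) (hb : b != 0) :
  [/\ exponentially_stable G
        (\big[Num.min/complex.Re (lambda (Ordinal hN))]_(i < N) complex.Re (lambda i)),
      exponentially_unstable G t0 &
      forall mu : R[i], mu ^+ 2 = lambda j -> 0 <= complex.Re mu ->
        `|complex.Im mu| = Num.sqrt ((Num.sqrt (a ^+ 2 + b ^+ 2) - a) / 2) /\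
        generic_modal_growth (lambda j) t0 `|complex.Im mu|].
Proof.
have [P [d [Pu PV PG]]] := normal_diagonalization hG.
have growth mu : mu ^+ 2 = lambda j ->
    [/\ 0 < `|complex.Im mu|,
      `|complex.Im mu| = Num.sqrt ((Num.sqrt (a ^+ 2 + b ^+ 2) - a) / 2) &
      generic_modal_growth (lambda j) t0 `|complex.Im mu|].
  rewrite hj => muE; have [mu0 muI [k kE kR]] := square_root_growth_rate muE hb.
  have Im0 : 0 < `|complex.Im mu| by rewrite normr_gt0.
  split => //; rewrite -kR; apply: generic_modal_growth_of_existence => //.
    by rewrite kR.
  by move=> y0 y1; apply: modal_solution_exists.
split; last 1 first.
- by move=> mu /growth[_ -> gm].
- apply: exponentially_stable_of_form => x.
  apply: (quadratic_form_ge hlambda Pu PG) => // i; exact: bigmin_le.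
have [i di] := eigenvalue_diag hlambda Pu PG j.
have [gp _ gm] := growth _ (sqr_sqrtc (lambda j)).
(* This pair is normalized because its product is the diagonal entry i of P P^-1. *)
apply: (@unstable_of_modal_growth _ _ _ _ _ (row i P) (col i (invmx P)) _ _ _ _ _ gp gm).
- rewrite -row_mul PG; apply/rowP => k; rewrite !mxE (bigD1 i) //= mxE eqxx.
  rewrite big1 ?addr0 -?di // => l li.
  by rewrite mxE eq_sym (negPf li) mul0r.
- have GE : map_mx (real_complex R) G *m invmx P = invmx P *m diag_mx d.
    by rewrite -[LHS](mulKmx Pu) [P *m _]mulmxA PG mulmxK.
  rewrite [in LHS]colE mulmxA GE -colE; apply/colP => k.
  by rewrite mxE mul_mx_diag !mxE di mulrC.
- rewrite rowE colE mulmxA -[_ *m P *m _]mulmxA mulmxV // mulmx1 mul_delta_mx.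
  by apply/matrixP => p q; rewrite !ord1 !mxE !eqxx.
- by rewrite hj.
Qed.
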